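(* There is an algorithm which, given any instance of $n$ jobs as described in the context (common integer length $p\ge 1$, and for each job $j$ integers $r_j$, $d_j$, $w_j\ge 0$), computes a maximum-weight feasible set of jobs (equivalently, together with an earliest-deadline schedule of that set, a preemptive schedule of maximum weighted throughput), and runs in time $O(n^4)$.
   Context: Scheduling problem $1|r_j;\,p_j=p;\,\text{pmtn}|\sum w_jU_j$. We are given $n$ jobs $1,\dots,n$, all of the same integer processing length $p\ge 1$; each job $j$ has an integer release time $r_j$, integer deadline $d_j$ and integer weight $w_j\ge 0$. A time unit $t$ (an integer) denotes the interval $[t,t+1)$. A preemptive schedule $S$ assigns to each job $j$ a set $S(j)$ of time units such that $S(j)\subseteq[r_j,d_j)$ for every $j$ and $S(i)\cap S(j)=\emptyset$ for $i\neq j$ (single machine; the time units assigned to a job need not be consecutive). The schedule completes job $j$ if $|S(j)|=p$. The weighted throughput of $S$ is $\sum_{j:\,|S(j)|=p} w_j$, and the goal is to maximize it. A set $\mathcal{J}$ of jobs is feasible if some schedule completes every job in $\mathcal{J}$; its weight is $w(\mathcal{J})=\sum_{j\in\mathcal{J}}w_j$. A maximum-weight feasible set is a feasible set of largest weight; its weight equals the maximum weighted throughput over all schedules. Running time is measured with unit-cost arithmetic and comparisons on the input integers. *)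

(* Defs.v *)
From HB Require Import structures.
From mathcomp Require Import all_boot all_order all_algebra.
From mathcomp Require Import finmap.

Set Implicit Arguments.
Unset Strict Implicit.
Unset Printing Implicit Defensive.

Import Order.TTheory GRing.Theory Num.Theory.

Local Open Scope ring_scope.
Local Open Scope fset_scope.

Record jobs (n : nat) := Jobs {
  len : int;
  release : 'I_n -> int;
  deadline : 'I_n -> int;
  weight : 'I_n -> int
}.

Definition valid_jobs n (I : jobs n) : Prop :=
  1 <= len I /\ forall j, 0 <= weight I j.

(* The integer t stands for the time unit [t, t + 1). *)
Definition assignment (n : nat) := 'I_n -> {fset int}.

Definition is_schedule n (I : jobs n) (S : assignment n) : Prop :=
  (forall j t, t \in S j -> release I j <= t < deadline I j) /\
  (forall i j, i != j -> [disjoint S i & S j]%fset).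

Definition completes n (I : jobs n) (S : assignment n) (j : 'I_n) : bool :=
  #|` S j |%:Z == len I.

Definition throughput n (I : jobs n) (S : assignment n) : int :=
  \sum_(j | completes I S j) weight I j.

Definition optimal_schedule n (I : jobs n) (S : assignment n) : Prop :=
  is_schedule I S /\
  forall S', is_schedule I S' -> throughput I S' <= throughput I S.

Definition feasible n (I : jobs n) (J : {set 'I_n}) : Prop :=
  exists2 S, is_schedule I S & forall j, j \in J -> completes I S j.

Definition set_weight n (I : jobs n) (J : {set 'I_n}) : int :=
  \sum_(j in J) weight I j.

Definition max_weight_feasible n (I : jobs n) (J : {set 'I_n}) : Prop :=
  feasible I J /\
  forall J', feasible I J' -> set_weight I J' <= set_weight I J.

(* Job j of J is released by time t and has received fewer than p units
   before t. *)
Definition pending n (I : jobs n) (J : {set 'I_n}) (S : assignment n)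
    (j : 'I_n) (t : int) : bool :=
  [&& j \in J, release I j <= t
    & #|` [fset u in S j | u < t] |%:Z < len I].

(* The earliest-deadline rule for J, ties broken arbitrarily. Meeting the
   deadlines is not part of the definition. *)
Definition edf_schedule n (I : jobs n) (J : {set 'I_n})
    (S : assignment n) : Prop :=
  [/\ forall i j, i != j -> [disjoint S i & S j]%fset,
      forall j t, t \in S j ->
        pending I J S j t /\
        forall i, pending I J S i t -> deadline I j <= deadline I i
    & forall i t, pending I J S i t -> exists j, t \in S j].

(* Algorithms are programs for a unit-cost random access machine on integers:
   scalar variables and one-dimensional arrays, all initially zero outside the
   input. The arithmetic operations are + and - only: unit-cost multiplication
   and division of unbounded integers would let a polynomial number of steps
   handle exponentially long numbers bit-parallel. A machine with more
   operations runs the same programs at the same cost. *)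

Inductive expr :=
| Const of int
| Var of nat
| Read of nat & expr
| Add of expr & expr
| Sub of expr & expr.

Inductive test :=
| Le of expr & expr
| Eq of expr & expr
| Not of test
| And of test & test.

Inductive cmd :=
| Skip
| Assign of nat & expr
| Write of nat & expr & expr
| Seq of cmd & cmd
| If of test & cmd & cmd
| While of test & cmd.

Record store := Store { var : nat -> int; arr : nat -> int -> int }.

Definition set_var (s : store) (x : nat) (v : int) : store :=
  Store (fun y => if y == x then v else var s y) (arr s).

Definition set_arr (s : store) (a : nat) (i v : int) : store :=
  Store (var s)
    (fun b k => if (b == a) && (k == i) then v else arr s b k).

Fixpoint eval (s : store) (e : expr) : int :=
  match e with
  | Const c => c
  | Var x => var s x
  | Read a e1 => arr s a (eval s e1)
  | Add e1 e2 => eval s e1 + eval s e2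
  | Sub e1 e2 => eval s e1 - eval s e2
  end.

Fixpoint eval_test (s : store) (b : test) : bool :=
  match b with
  | Le e1 e2 => eval s e1 <= eval s e2
  | Eq e1 e2 => eval s e1 == eval s e2
  | Not b1 => ~~ eval_test s b1
  | And b1 b2 => eval_test s b1 && eval_test s b2
  end.

Fixpoint expr_cost (e : expr) : nat :=
  match e with
  | Const _ | Var _ => 1%N
  | Read _ e1 => (expr_cost e1).+1
  | Add e1 e2 | Sub e1 e2 => (expr_cost e1 + expr_cost e2).+1%N
  end.

Fixpoint test_cost (b : test) : nat :=
  match b with
  | Le e1 e2 | Eq e1 e2 => (expr_cost e1 + expr_cost e2).+1%N
  | Not b1 => (test_cost b1).+1
  | And b1 b2 => (test_cost b1 + test_cost b2).+1%N
  end.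

(* exec c s s' k: started in s, c halts in s' after k steps. *)
Inductive exec : cmd -> store -> store -> nat -> Prop :=
| ExecSkip s : exec Skip s s 1%N
| ExecAssign s x e :
    exec (Assign x e) s (set_var s x (eval s e)) (expr_cost e).+1
| ExecWrite s a e1 e2 :
    exec (Write a e1 e2) s (set_arr s a (eval s e1) (eval s e2))
      (expr_cost e1 + expr_cost e2).+1%N
| ExecSeq s s1 s2 c1 c2 k1 k2 :
    exec c1 s s1 k1 -> exec c2 s1 s2 k2 -> exec (Seq c1 c2) s s2 (k1 + k2)%N
| ExecIfT s s' b c1 c2 k :
    eval_test s b -> exec c1 s s' k ->
    exec (If b c1 c2) s s' (test_cost b + k).+1%N
| ExecIfF s s' b c1 c2 k :
    ~~ eval_test s b -> exec c2 s s' k ->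
    exec (If b c1 c2) s s' (test_cost b + k).+1%N
| ExecWhileF s b c :
    ~~ eval_test s b -> exec (While b c) s s (test_cost b).+1
| ExecWhileT s s1 s2 b c k1 k2 :
    eval_test s b -> exec c s s1 k1 -> exec (While b c) s1 s2 k2 ->
    exec (While b c) s s2 (test_cost b + k1 + k2).+1%N.

Definition input_array n (f : 'I_n -> int) (i : int) : int :=
  if i is Posz k then oapp f 0 (insub k) else 0.

(* Variables 0 and 1 hold n and p; arrays 0, 1 and 2 hold the release times,
   deadlines and weights, at indices 0, ..., n - 1. *)
Definition input_store n (I : jobs n) : store :=
  Store
    (fun x => match x with 0%N => n%:Z | 1%N => len I | _ => 0 end)
    (fun a => match a with
              | 0%N => input_array (release I)
              | 1%N => input_array (deadline I)
              | 2%N => input_array (weight I)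
              | _ => fun=> 0
              end).

(* Array 3 holds the characteristic vector of the computed set. *)
Definition output_set n (s : store) : {set 'I_n} :=
  [set j : 'I_n | arr s 3 (j : nat)%:Z != 0].

(* Main.v *)
Require Import Defs.
From mathcomp Require Import all_boot all_order all_algebra.
From mathcomp Require Import finmap.
From mathcomp Require Import zify ring.

(** By a Hall-type theorem a set is feasible iff, for all x and y, its jobs
    released at x or later and due by y or earlier fit into [x, y).  Jobs are
    inserted in the order of their deadlines.  Let R 0 <= R 1 <= ... be the
    sorted release times.  An entry V(a, i) is the weight of a feasible set of
    inserted jobs that fits into [R a, R a + i p), and is optimal among the sets
    of i jobs that keep the machine busy throughout this interval.

    Consider a busy block, starting at R a, that contains the last inserted job
    k and that k finishes.  Job k has the lowest priority, so it runs exactly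
    when the other jobs of the block leave the machine idle, and this idle time
    lies after r_k.  The other jobs form a chain of busy blocks.  Before the
    start R b of any of these, the total idle time is less than p, so the number
    of jobs done by then is floor((R b - R a) / p): it is determined by a and b.
    Hence for fixed k and a the best chains T(b) cost O(n^2), which gives O(n^4)
    over all k and a.  Other busy blocks that contain k are concatenations of
    such blocks with smaller ones.

    Along with its weight, each table entry carries its set, encoded as the sum
    of the powers 2^j of its members j, so that disjoint unions are sums. *)

Set Implicit Arguments.
Unset Strict Implicit.
Unset Printing Implicit Defensive.

Import Order.TTheory GRing.Theory Num.Theory.

Local Open Scope ring_scope.

(** * Sets of jobs that satisfy the Hall condition *)

Section Sets.

Variables (n : nat) (I : jobs n).
Hypothesis len_gt0 : 1 <= len I.

Implicit Types (J K : {set 'I_n}) (x y e s t : int).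

Notation p := (len I).
Notation r := (release I).
Notation d := (deadline I).

(** By the Hall condition all statements about the tables are about numbers of arrivals; schedules
    enter only in showing that the condition characterises feasibility. A new job [k] of largest
    deadline changes only the conditions with [y >= d k], so an insertion needs a single deadline
    test, comparing the end of its block with [d k].

    Idle time before [R b] stays below [p] because a busy block is cut into pieces without a busy
    proper initial part: were [p] idle units available by then, [k] would be finished in them, and
    the jobs seen so far would be such an initial part.

    Upper and lower bounds are kept apart. Optimality is a system of inequalities between the
    entries and the weights of busy sets; feasibility says that each entry belongs to a set that
    merely fits. [V] can therefore be updated in place, its entries only growing.

    The machine has no multiplication or division, so quotients are counted and products replaced by
    running sums. Every loop runs [n] or [n + 1] times, so the exponent of the running time is the
    nesting depth. *)

Definition late J x : nat := #|[set j in J | x <= r j]|.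
Definition early J x : nat := #|[set j in J | r j < x]|.
Definition due J y : {set 'I_n} := [set j in J | d j <= y].

(** A machine that never idles while work is available is through with [J] by time [e], whatever its
    priorities. The guard excludes points [x] after the last release, for which the inequality would
    bound [x] itself. *)
Definition done_by J e : Prop :=
  forall x, (0 < late J x)%N -> x + p * (late J x)%:Z <= e.

Definition good J : Prop := forall y, done_by (due J y) y.

(** A busy block: the work released before [x] fills [[s, x)], so the machine cannot idle in
    [[s, s + p #|J|)]. *)
Definition compact J s : Prop :=
  (forall j, j \in J -> s <= r j) /\
  (forall x, x <= s + p * #|J|%:Z -> x - s <= p * (early J x)%:Z).

Lemma len_leM (a b : nat) : (a <= b)%N -> p * a%:Z <= p * b%:Z.
Proof. by move=> ab; rewrite ler_wpM2l ?lez_nat //; lia. Qed.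

Lemma late_early J x : (late J x + early J x = #|J|)%N.
Proof.
rewrite -(cardsID [set j | x <= r j] J); congr addn; apply: eq_card => j.
  by rewrite !inE.
by rewrite !inE ltNge andbC.
Qed.

Lemma lateS J J' x : J \subset J' -> (late J x <= late J' x)%N.
Proof.
move=> /subsetP sJ; apply/subset_leq_card/subsetP => j; rewrite !inE.
by case/andP => /sJ -> ->.
Qed.

Lemma leq_late J x y : x <= y -> (late J y <= late J x)%N.
Proof.
move=> xy; apply/subset_leq_card/subsetP => j; rewrite !inE.
by case/andP => -> /(le_trans xy) ->.
Qed.

Lemma leq_early J x y : x <= y -> (early J x <= early J y)%N.
Proof. by move=> /(leq_late J); have := late_early J x; have := late_early J y; lia. Qed.

Lemma late_all J x : (forall j, j \in J -> x <= r j) -> late J x = #|J|.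
Proof.
move=> xJ; apply: eq_card => j; rewrite !inE.
by case: (boolP (j \in J)) => // /xJ ->.
Qed.

Lemma early0 J x : (forall j, j \in J -> x <= r j) -> early J x = 0%N.
Proof. by move=> /late_all xJ; have := late_early J x; lia. Qed.

Lemma early_gt0 J x j : j \in J -> r j < x -> (0 < early J x)%N.
Proof. by move=> jJ jx; apply/card_gt0P; exists j; rewrite inE jJ. Qed.

Lemma late_gt0P J x : reflect (exists2 j, j \in J & x <= r j) (0 < late J x)%N.
Proof.
apply: (iffP card_gt0P) => [[j]|[j jJ xj]]; last by exists j; rewrite inE jJ.
by rewrite inE => /andP[]; exists j.
Qed.

Lemma early_gt0P J x : reflect (exists2 j, j \in J & r j < x) (0 < early J x)%N.
Proof.
apply: (iffP card_gt0P) => [[j]|[j jJ xj]]; last by exists j; rewrite inE jJ.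
by rewrite inE => /andP[]; exists j.
Qed.

Lemma early_le_card J x : (early J x <= #|J|)%N.
Proof. by rewrite -(late_early J x) leq_addl. Qed.

Lemma cardU_disjoint J1 J2 : [disjoint J1 & J2] ->
  #|J1 :|: J2| = (#|J1| + #|J2|)%N.
Proof. by rewrite -(leq_card_setU J1 J2).2 => /eqP. Qed.

Lemma lateU J1 J2 x : [disjoint J1 & J2] ->
  late (J1 :|: J2) x = (late J1 x + late J2 x)%N.
Proof.
move=> dis; rewrite -cardU_disjoint; first by
  apply: eq_card => j; rewrite !inE andb_orl.
apply/pred0P => j /=; rewrite !inE; apply/negP => /andP[/andP[j1 _] /andP[j2 _]].
by have := disjointFr dis j1; rewrite j2.
Qed.

Lemma earlyU J1 J2 x : [disjoint J1 & J2] ->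
  early (J1 :|: J2) x = (early J1 x + early J2 x)%N.
Proof.
move=> dis; have := lateU x dis; have := cardU_disjoint dis.
have := late_early J1 x; have := late_early J2 x.
have := late_early (J1 :|: J2) x; lia.
Qed.

Lemma late1 k x : late [set k] x = (x <= r k).
Proof.
case: (boolP (x <= r k)) => xk.
  by rewrite late_all ?cards1 // => j; rewrite inE => /eqP ->.
apply/eqP; rewrite /late cards_eq0; apply/eqP/setP => j; rewrite !inE.
by apply/negP => /andP[/eqP -> ]; apply/negP.
Qed.

Lemma dueS J J' y : J \subset J' -> due J y \subset due J' y.
Proof.
move=> /subsetP sJ; apply/subsetP => j; rewrite !inE.
by case/andP => /sJ -> ->.
Qed.

Lemma due_sub J y : due J y \subset J.
Proof. by apply/subsetP => j; rewrite inE => /andP[]. Qed.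

Lemma dueU J1 J2 y : due (J1 :|: J2) y = due J1 y :|: due J2 y.
Proof. by apply/setP => j; rewrite !inE andb_orl. Qed.

Lemma done_byS J J' e : J \subset J' -> done_by J' e -> done_by J e.
Proof.
move=> sJ hJ' x xJ; have le := lateS x sJ.
by apply: le_trans (hJ' x (leq_trans xJ le)); rewrite lerD2l len_leM.
Qed.

Lemma done_by_le J e e' : e <= e' -> done_by J e -> done_by J e'.
Proof. by move=> ee' hJ x /hJ /le_trans; apply. Qed.

Lemma goodS J J' : J \subset J' -> good J' -> good J.
Proof. by move=> sJ hJ' y; apply: done_byS (hJ' y); apply: dueS. Qed.

Lemma done_by0 e : done_by set0 e.
Proof. by move=> x /late_gt0P[j]; rewrite inE. Qed.

Lemma good0 : good set0.
Proof.
move=> y; apply: (@done_byS _ set0 y (due_sub _ _)); exact: done_by0.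
Qed.

Lemma done_by_card J s e : J != set0 -> (forall j, j \in J -> s <= r j) ->
  done_by J e -> s + p * #|J|%:Z <= e.
Proof.
move=> J0 sJ hJ; rewrite -(late_all sJ); apply: hJ.
by rewrite late_all // card_gt0.
Qed.

Lemma done_by_card_le J s (m : nat) : (forall j, j \in J -> s <= r j) ->
  done_by J (s + p * m%:Z) -> (#|J| <= m)%N.
Proof.
move=> sJ hJ; have [->|J0] := eqVneq J set0; first by rewrite cards0.
have := done_by_card J0 sJ hJ; rewrite lerD2l ler_pM2l; last by lia.
by rewrite lez_nat.
Qed.

Lemma done_by_release J e j : done_by J e -> j \in J -> r j < e.
Proof.
move=> hJ jJ; have l0 : (0 < late J (r j))%N by apply/late_gt0P; exists j.
have := hJ _ l0; have := len_leM l0; lia.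
Qed.

Lemma disjoint_release J1 J2 s : done_by J1 s ->
  (forall j, j \in J2 -> s <= r j) -> [disjoint J1 & J2].
Proof.
move=> h1 h2; apply/pred0P => j /=; apply/negP => /andP[/(done_by_release h1)].
by move=> js /h2; rewrite leNgt js.
Qed.

(** If some job of [J1] is released at [x] or later, then those jobs end by [s], and all of [J2]
    fits between [s] and [e]; otherwise only [J2] is counted. *)
Lemma done_byU J1 J2 s e : done_by J1 s -> done_by J1 e ->
  (forall j, j \in J2 -> s <= r j) -> done_by J2 e -> done_by (J1 :|: J2) e.
Proof.
move=> h1 h1e h2 h2e x; rewrite lateU; last exact: disjoint_release h1 h2.
have [->|l1] := posnP (late J1 x); first by rewrite add0n; exact: h2e.
have [->|l2] := posnP (late J2 x); first by rewrite addn0 => _; exact: h1e.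
move=> _; have := h1 _ l1.
have J2N : J2 != set0 by case/late_gt0P: l2 => j j2 _; apply/set0Pn; exists j.
have := done_by_card J2N h2 h2e.
have : (late J2 x <= #|J2|)%N by have := late_early J2 x; lia.
by move=> /len_leM; rewrite PoszD mulrDr; lia.
Qed.

Lemma goodU J1 J2 s : done_by J1 s -> good J1 ->
  (forall j, j \in J2 -> s <= r j) -> good J2 -> good (J1 :|: J2).
Proof.
move=> h1 g1 h2 g2 y; rewrite dueU; apply: (@done_byU _ _ s) => //.
- by apply: done_byS h1; apply: due_sub.
- by move=> j /(subsetP (due_sub _ _)) /h2.
Qed.

Lemma done_by_add J k e : k \notin J -> done_by J e ->
  (forall x, x <= r k -> x + p * (late J x)%:Z + p <= e) ->
  done_by (k |: J) e.
Proof.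
move=> kJ hJ hk x; rewrite lateU ?disjoints1 // late1.
case: (boolP (x <= r k)) => xk; last exact: hJ.
by move=> _; have := hk _ xk; rewrite PoszD mulrDr; lia.
Qed.

(** For [y < d k] the due set does not contain [k] and is unchanged; for [y >= d k] every due set is
    a subset of one that ends by [e <= y]. *)
Lemma good_add J k e : good J -> (forall j, j \in J -> d j <= d k) ->
  done_by (k |: J) e -> e <= d k -> good (k |: J).
Proof.
move=> gJ Jk hJ ek y; case: (lerP (d k) y) => ky.
  by apply: (@done_by_le _ e); [lia | apply: done_byS hJ; apply: due_sub].
suff -> : due (k |: J) y = due J y by [].
apply/setP => j; rewrite !inE; case: eqP => [->|//].
by rewrite leNgt ky /= !andbF.
Qed.

(** * Busy blocks and their decomposition *)

(** Late and early jobs add up to [#|J|], so the lower bound on arrivals before [x] is an upper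
    bound on the work arriving from [x] on. Beyond the end of the block no job is released, since
    [#|J|] jobs have arrived by then. *)
Lemma compact_done_by J s : compact J s -> done_by J (s + p * #|J|%:Z).
Proof.
move=> [sJ hJ] x xJ; have := late_early J x.
case: (lerP x (s + p * #|J|%:Z)) => [/hJ|xe].
  by move=> h <-; rewrite PoszD mulrDr; lia.
move: xJ => /late_gt0P[j jJ xj].
have := hJ _ (lexx (s + p * #|J|%:Z)).
have -> : s + p * #|J|%:Z - s = p * #|J|%:Z by lia.
rewrite ler_pM2l ?lez_nat; last by lia.
have := late_early J (s + p * #|J|%:Z).
have : (0 < late J (s + p * #|J|%:Z))%N by apply/late_gt0P; exists j => //; lia.
by lia.
Qed.

Lemma compact_start J s : compact J s -> J != set0 ->
  exists2 j, j \in J & r j = s.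
Proof.
move=> [sJ hJ] J0; have J1 : (1 <= #|J|)%N by rewrite card_gt0.
have : s + 1 <= s + p * #|J|%:Z by have := len_leM J1; lia.
move=> /hJ h; have /early_gt0P[j jJ js] : (0 < early J (s + 1))%N by lia.
by exists j => //; have := sJ _ jJ; lia.
Qed.

(** Here [l.+1] is the ceiling of [y / p]. It reduces a busy condition at all points to one at
    multiples of [p]. *)
Lemma div_up y : 0 < y -> exists l : nat, p * l%:Z < y <= p * l.+1%:Z.
Proof.
move=> y0; exists `|((y - 1) %/ p)%Z|%N.
have q0 : 0 <= ((y - 1) %/ p)%Z by rewrite divz_ge0; lia.
have e1 := divz_eq (y - 1) p.
have e2 : 0 <= ((y - 1) %% p)%Z by rewrite modz_ge0; lia.
have e3 : ((y - 1) %% p)%Z < p by rewrite ltz_pmod; lia.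
rewrite intS gez0_abs // mulrDr mulr1.
by move: e1 e2 e3; rewrite (mulrC _ p); lia.
Qed.

Definition first_jobs J t : {set 'I_n} := [set j in J | r j < t].

Lemma first_jobs_disjoint J t : [disjoint first_jobs J t & J :\: first_jobs J t].
Proof. by rewrite disjoint_sym disjoints_subset setDE subsetIr. Qed.

Lemma first_jobsU J t : first_jobs J t :|: (J :\: first_jobs J t) = J.
Proof.
by apply/setP => j; rewrite !inE; case: (j \in J); case: (_ < _).
Qed.

Lemma first_jobs_sub J t : first_jobs J t \subset J.
Proof. by apply/subsetP => j; rewrite inE => /andP[]. Qed.

Lemma rest_ge J t j : j \in J :\: first_jobs J t -> t <= r j.
Proof. by rewrite !inE; case: (j \in J); rewrite ?andbF // andbT -leNgt. Qed.

Lemma card_rest J t : #|J| = (early J t + #|J :\: first_jobs J t|)%N.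
Proof. by rewrite -[in LHS](first_jobsU J t) cardU_disjoint ?first_jobs_disjoint. Qed.

Lemma early_first_jobs J t x : x <= t -> early (first_jobs J t) x = early J x.
Proof.
move=> xt; apply: eq_card => j; rewrite !inE.
by case: (ltrP (r j) x) => jx; rewrite ?andbF //= !andbT; case: (j \in J) => //=; lia.
Qed.

Lemma early_rest J t x : t <= x ->
  early J x = (early J t + early (J :\: first_jobs J t) x)%N.
Proof.
move=> tx; rewrite -[in LHS](first_jobsU J t) earlyU ?first_jobs_disjoint //.
congr addn; apply: eq_card => j; rewrite !inE.
by case: (j \in J) => //=; case: (ltrP (r j) t) => //= jt; lia.
Qed.

(* The counting form of "the machine is busy during [s, s + g p)": at the l-th
   multiple of p, more than l - 1 jobs have arrived. *)
Lemma compact_first_jobs J s (g : nat) : (forall j, j \in J -> s <= r j) ->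
  early J (s + p * g%:Z) = g ->
  (forall l : nat, (l < g)%N -> ((l < early J (s + p * l%:Z))%N \/
      (l = 0%N /\ exists2 j, j \in J & r j = s))) ->
  compact (first_jobs J (s + p * g%:Z)) s.
Proof.
move=> sJ cg hl; split; first by move=> j /(subsetP (first_jobs_sub _ _)) /sJ.
move=> x; rewrite (_ : #|_| = g) // => xe; rewrite early_first_jobs //.
case: (lerP x s) => xs; first by rewrite (@le_trans _ _ 0) //; [lia|rewrite mulr_ge0 //; lia].
have /div_up[l /andP[lx xl]] : 0 < x - s by lia.
apply: (le_trans xl); apply: len_leM.
have lg : (l < g)%N.
  by have : p * l%:Z < p * g%:Z by [lia]; rewrite ltr_pM2l ?ltz_nat //; lia.
case: (hl _ lg) => [lt|[l0 [j jJ js]]].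
  by apply: (leq_trans lt); apply: leq_early; lia.
by rewrite l0 (early_gt0 jJ) // js.
Qed.

(* No proper initial part of the block J is a busy block by itself. *)
Definition prime_at J s : Prop :=
  forall l : nat, (0 < l)%N -> (l < #|J|)%N -> (l < early J (s + p * l%:Z))%N.

(** Take the least [g > 0] such that at most [g] jobs arrive before [s + p g]. By minimality every
    smaller positive multiple of [p] sees more arrivals than it has room for, which yields both
    busyness and primality. *)
Lemma first_block J s : (forall j, j \in J -> s <= r j) ->
  (exists2 j, j \in J & r j = s) ->
  exists g : nat, let J1 := first_jobs J (s + p * g%:Z) in
    [/\ (0 < g)%N, #|J1| = g, compact J1 s & prime_at J1 s].
Proof.
move=> sJ [j0 j0J j0s].
pose P g := (0 < g)%N && (early J (s + p * g%:Z) <= g)%N.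
have exP : exists g, P g.
  exists #|J|; rewrite /P; apply/andP; split; first by apply/card_gt0P; exists j0.
  by have := late_early J (s + p * #|J|%:Z); lia.
case: (ex_minnP exP) => g /andP[g0 hg] gmin; exists g => /=.
have lt l : (0 < l)%N -> (l < g)%N -> (l < early J (s + p * l%:Z))%N.
  move=> l0 lg; rewrite ltnNge; apply/negP => hl.
  by have := gmin l; rewrite /P l0 hl => /(_ isT); lia.
(* More than [g - 1] jobs have arrived one multiple earlier; for [g = 1] the job released at [s] is
   the one that counts. *)
have cg : early J (s + p * g%:Z) = g.
  apply/eqP; rewrite eqn_leq hg /=; case: (ltnP 1 g) => g1.
    have le1 : (early J (s + p * g.-1%:Z) <= early J (s + p * g%:Z))%N.
      by apply: leq_early; rewrite lerD2l len_leM //; lia.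
    by have := lt g.-1; lia.
  have := @early_gt0 J (s + p * g%:Z) j0 j0J; rewrite j0s.
  have := len_leM g0; lia.
split => //.
  apply: compact_first_jobs => // l lg; case: (posnP l) => [->|l0].
    by right; split=> //; exists j0.
  by left; apply: lt.
move=> l l0; rewrite (_ : #|_| = g) // => lg; rewrite early_first_jobs ?lt //.
by rewrite lerD2l len_leM // ltnW.
Qed.

(** Exactly [g] jobs arrive before [s + p g], so subtracting their work shifts the busy condition to
    the new start without loss. *)
Lemma compact_rest J s (g : nat) : compact J s ->
  early J (s + p * g%:Z) = g ->
  compact (J :\: first_jobs J (s + p * g%:Z)) (s + p * g%:Z).
Proof.
move=> [sJ hJ] cg; split; first by move=> j /rest_ge.
move=> x xe; have cJ := card_rest J (s + p * g%:Z).
rewrite cg in cJ; have le0 : x <= s + p * #|J|%:Z.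
  by move: xe; rewrite cJ PoszD mulrDr; lia.
case: (lerP (s + p * g%:Z) x) => gx; last first.
  by apply: (@le_trans _ _ 0); [lia | apply: mulr_ge0; lia].
have := hJ _ le0; rewrite (early_rest _ gx) cg PoszD mulrDr; lia.
Qed.

(** The summand is a parameter because weights and set codes are both sums over members. *)
Definition total (f : 'I_n -> int) J : int := \sum_(j in J) f j.

Notation w := (total (weight I)).

Lemma totalU f J1 J2 : [disjoint J1 & J2] ->
  total f (J1 :|: J2) = total f J1 + total f J2.
Proof. move=> dis; rewrite /total -bigU //=; apply: eq_bigl => j; by rewrite !inE. Qed.

Lemma total0 f : total f set0 = 0.
Proof. by rewrite /total big_set0. Qed.

Lemma total_first f J t :
  total f J = total f (first_jobs J t) + total f (J :\: first_jobs J t).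
Proof. by rewrite -[in LHS](first_jobsU J t) totalU ?first_jobs_disjoint. Qed.

Lemma total_setD1 f J k : k \in J -> total f J = f k + total f (J :\ k).
Proof. by move=> kJ; rewrite /total (big_setD1 k). Qed.

Lemma total_setU1 f J k : k \notin J -> total f (k |: J) = f k + total f J.
Proof. by move=> kJ; rewrite /total big_setU1. Qed.

(** [R n] serves as an end point no earlier than any deadline, where the final chain stops. *)
Variable R : nat -> int.
Hypothesis R_mono : forall a b, (a <= b <= n)%N -> R a <= R b.
Hypothesis R_release : forall j, exists2 b, (b < n)%N & R b = r j.
Hypothesis R_last : forall j, d j <= R n.

Lemma R_lt a b : (a < n)%N -> R a < R b -> (a < b)%N.
Proof.
move=> an; rewrite !ltNge ltnNge; apply: contra => ba.
by apply: R_mono; rewrite ba ltnW.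
Qed.

Lemma min_release J : J != set0 -> exists2 b, (b < n)%N &
  (forall j, j \in J -> R b <= r j) /\ (exists2 j, j \in J & r j = R b).
Proof.
case/set0Pn => j0 j0J; case: (Order.TotalTheory.arg_minP r j0J) => j jJ jmin.
by have [b bn Rb] := R_release j; exists b => //; rewrite Rb; split=> //; exists j.
Qed.

(* m is floor((R b - R a) / p), and r_k <= R a + p m, so that job k can use all
   the idle time that a chain of m jobs leaves in [R a, R b). *)
Definition tick k a b (m : nat) : bool :=
  [&& R a + p * m%:Z <= R b, R b < R a + p * m%:Z + p & r k <= R a + p * m%:Z].

(** * Completeness: inequalities that make the table entries large enough *)

Definition block_complete K (v : nat -> nat -> int) : Prop :=
  forall J a, (a < n)%N -> J \subset K -> good J -> compact J (R a) ->
  w J <= v a #|J|.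

(** The first inequality is the chain consisting of one block of [m] jobs; the second appends a
    block of [m - m'] jobs at [R b'], provided it ends by [R b]. *)
Definition chain_table k a (v : nat -> nat -> int) (T : nat -> int) : Prop :=
  forall b m, (b < n)%N -> (m <= n)%N -> tick k a b m -> v a m <= T b /\
  forall b' m', (b' < b)%N -> (m' <= m)%N -> tick k a b' m' ->
    R b' + p * (m - m')%N%:Z <= R b -> T b' + v b' (m - m')%N <= T b.

(** The other [i] jobs either form a single block, during or at the end of which [k] is released, or
    a chain up to [R b] followed by a last block of [i - m] jobs. The guards on [k] hold for every
    good busy block of [i.+1] jobs in which [k] has the largest deadline. *)
Definition insert_table k (v A : nat -> nat -> int) : Prop :=
  forall a i, (a < n)%N -> (i < n)%N -> R a <= r k ->
  R a + p * i%:Z + p <= d k ->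
  (r k <= R a + p * i%:Z -> weight I k + v a i <= A a i.+1) /\
  exists2 T, chain_table k a v T &
    forall b m, (b < n)%N -> (m <= i)%N -> tick k a b m ->
      weight I k + (T b + v b (i - m)%N) <= A a i.+1.

(** The right part is read from the new table at a later start, so that blocks with any number of
    pieces are covered. *)
Definition join_table (v A v' : nat -> nat -> int) : Prop :=
  forall a, (a < n)%N ->
  (forall i, (i <= n)%N -> v a i <= v' a i /\ ((0 < i)%N -> A a i <= v' a i)) /\
  forall b m i, (b < n)%N -> R a < R b -> R a + p * m%:Z = R b ->
    (m + i <= n)%N ->
    v a m + v' b i <= v' a (m + i)%N /\ A a m + v' b i <= v' a (m + i)%N.

Lemma lenS (l : nat) : p * l.+1%:Z = p * l%:Z + p.
Proof. by rewrite -addn1 PoszD mulrDr mulr1. Qed.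

Lemma card_le_n J : (#|J| <= n)%N.
Proof. by rewrite -[X in (_ <= X)%N](card_ord n) max_card. Qed.

(** Induction over the blocks of the jobs still to come, the earlier ones being accounted for by
    [T b]. Of the [l] jobs of the whole block, [m] precede [R b], [#|J|] follow, and the remaining
    one is [k]. The last hypothesis is what primality leaves once [k] is removed. *)
Lemma chain_complete K k a v (A : int) (l : nat) T J b (m : nat) :
  block_complete K v -> chain_table k a v T -> (l <= n)%N ->
  (forall b m, (b < n)%N -> (m < l)%N -> tick k a b m ->
      weight I k + (T b + v b (l - m.+1)%N) <= A) ->
  J != set0 -> J \subset K -> good J ->
  (b < n)%N -> (forall j, j \in J -> R b <= r j) ->
  (exists2 j, j \in J & r j = R b) ->
  tick k a b m -> l = (m + #|J|).+1 ->
  (forall l', (m < l')%N -> (l' < l)%N ->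
     (l' - m <= early J (R a + p * l'%:Z))%N) ->
  weight I k + (T b + w J) <= A.
Proof.
move=> Vc Tc ln hA; elim: {J}_.+1 {-2}J (ltnSn #|J|) b m => // sz IH J Jsz b m.
move=> J0 JK gJ bn RJ Rj tb lE hc.
have [g /= [g0 cg cJ1 _]] := first_block RJ Rj.
set t := R b + p * g%:Z in cg cJ1.
have tE := total_first (weight I) J t; have cE := card_rest J t.
have eg : early J t = g by [].
have ml : (m < l)%N by lia.
have s1 := subset_trans (first_jobs_sub J t) JK.
have v1 : w (first_jobs J t) <= v b g.
  by rewrite -cg; apply: Vc => //; apply: goodS gJ; apply: first_jobs_sub.
have [E0|E0] := eqVneq (J :\: first_jobs J t) set0.
  rewrite E0 total0 addr0 in tE; rewrite E0 cards0 addn0 in cE.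
  have := hA b m bn ml tb; rewrite tE (_ : (l - m.+1)%N = g); last by lia.
  by lia.
have [b2 b2n [RJ2 [j2 j2J2 Rj2]]] := min_release E0.
have tb2 : t <= R b2 by rewrite -Rj2; apply: rest_ge j2J2.
have J2gt0 : (0 < #|J :\: first_jobs J t|)%N by rewrite card_gt0.
have mgl : ((m + g).+1 < l)%N by lia.
case/and3P: (tb) => tb1 tb3 tb4.
have pg0 : p <= p * g%:Z by have := len_leM g0; rewrite mulr1.
(* If [R b2] were [p] or more after [R a + p (m + g)], only [g] jobs of [J] would have arrived by
   [R a + p (m + g + 1)], whereas [hc] demands [g + 1]. *)
have tick2 : tick k a b2 (m + g)%N.
  apply/and3P; rewrite PoszD mulrDr; split; [by lia | | by lia].
  rewrite ltNge; apply/negP => le2.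
  have mlt : (m < (m + g).+1)%N by lia.
  have := hc _ mlt mgl; rewrite lenS PoszD mulrDr.
  have := leq_early J le2; rewrite !addrA.
  rewrite (early_rest J tb2) eg (early0 RJ2) => e1 e2.
  by have := leq_trans e2 e1; lia.
have bb2 : (b < b2)%N by apply: R_lt => //; lia.
have mgn : (m + g <= n)%N by lia.
have [_ /(_ b m bb2 (leq_addr _ _) tb)] := Tc b2 _ b2n mgn tick2.
rewrite addKn => /(_ tb2) Tb2.
suff : weight I k + (T b2 + w (J :\: first_jobs J t)) <= A by lia.
apply: (IH _ _ b2 (m + g)%N) => //.
- by lia.
- by apply: subset_trans JK; apply: subsetDl.
- by apply: goodS gJ; apply: subsetDl.
- by exists j2.
- by lia.
move=> l' l1 l2; have := hc l' _ l2.
have tl : t <= R a + p * l'%:Z.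
  have := len_leM l1; rewrite lenS; lia.
rewrite (early_rest J tl) eg; lia.
Qed.

Lemma earlyD1 J k x : k \in J ->
  early J x = (early (J :\ k) x + (r k < x)%R)%N.
Proof.
move=> kJ; have dis : [disjoint [set k] & J :\ k] by rewrite disjoints1 !inE eqxx.
rewrite -{1}(setD1K kJ) earlyU // addnC; congr addn.
have := late_early [set k] x; rewrite late1 cards1; case: lerP; lia.
Qed.

(** Without [k], the block falls apart into busy blocks. Up to the first gap that [k] can use, the
    others form one block starting at [R a]; what comes after it is a chain, whose idle time is kept
    below [p] by primality. *)
Lemma insert_complete K k v A J a : block_complete K v -> insert_table k v A ->
  (forall j, j \in K -> d j <= d k) ->
  (a < n)%N -> k \in J -> J :\ k \subset K -> good J -> compact J (R a) ->
  prime_at J (R a) -> w J <= A a #|J|.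
Proof.
move=> Vc iA Kk an kJ JK gJ cJ pJ.
have J0 : J != set0 by apply/set0Pn; exists k.
have RJ := cJ.1; have dJ := compact_done_by cJ.
have cE := cardsD1 k J; rewrite kJ add1n in cE.
have eD x : early J x = _ := earlyD1 x kJ.
set J' := J :\ k in JK cE eD; set i := #|J'| in cE.
have iln : (i < n)%N by rewrite -cE card_le_n.
have wE : w J = weight I k + w J' by exact: total_setD1.
have gJ' : good J' by apply: goodS gJ; apply: subsetDl.
have RJ' j : j \in J' -> R a <= r j by rewrite inE => /andP[_ /RJ].
have rk : r k + p <= R a + p * #|J|%:Z.
  have lk : (0 < late J (r k))%N by apply/late_gt0P; exists k.
  by have := dJ _ lk; have := len_leM lk; lia.
(* All of [J] is due by [d k], so the Hall condition at [d k] bounds the end of the block. *)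
have dk : R a + p * #|J|%:Z <= d k.
  apply: done_by_card => //; suff E : due J (d k) = J by rewrite -E; exact: gJ.
  apply/setP => j; rewrite !inE; case: (boolP (j \in J)) => //= jJ.
  have [->|jk] := eqVneq j k; first by rewrite lexx.
  apply: Kk; apply: (subsetP JK).
  by rewrite !inE jk.
rewrite cE lenS in rk dk.
have [A1 [T Tc A2]] := iA a i an iln (RJ _ kJ) ltac:(lia).
(* Primality gives more than [l'] arrivals, of which at most one is [k]. *)
have hc l' : (0 < l')%N -> (l' <= i)%N -> (l' <= early J' (R a + p * l'%:Z))%N.
  move=> l0 li; have := pJ l' l0; rewrite eD cE => /(_ li).
  by case: (_ < _) => /=; lia.
(* The least such [l] marks the first multiple of [p], from [r k] on, at which the other jobs leave
   no work behind. *)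
pose P l := (r k <= R a + p * l%:Z) && (early J' (R a + p * l%:Z) <= l)%N.
have exP : exists l, P l.
  by exists i; rewrite /P early_le_card andbT; lia.
case: (ex_minnP exP) => l1 /andP[rl1 el1] lmin.
have l1i : (l1 <= i)%N.
  by apply: lmin; rewrite /P early_le_card andbT; lia.
have eE : early J' (R a + p * l1%:Z) = l1.
  by case: (posnP l1) el1 => [->|l0]; [lia | have := hc _ l0 l1i; lia].
have c1 : compact (first_jobs J' (R a + p * l1%:Z)) (R a).
  apply: compact_first_jobs => // l ll1; case: (posnP l) => [l0|l0].
    (* The block starts with a job other than [k]: were [k] the job released at [R a], then [P 0]
       would hold and [l1] would be 0. *)
    right; split=> //; have [j jJ jR] := compact_start cJ J0.
    exists j => //; rewrite !inE jJ andbT; apply/eqP => jk.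
    have := lmin 0%N; rewrite /P mulr0 addr0 (early0 RJ') -jk jR lexx.
    by move=> /(_ isT); lia.
  left; rewrite ltnNge; apply/negP => el; have := lmin l; rewrite /P el andbT.
  case: lerP => rl; first by move=> /(_ isT); lia.
  move: el; have := pJ l l0; rewrite eD cE (_ : (r k < _) = false).
    by rewrite addn0; lia.
  by apply/negbTE; rewrite -leNgt ltW.
have v1 : w (first_jobs J' (R a + p * l1%:Z)) <= v a l1.
  have {2}<- : #|first_jobs J' (R a + p * l1%:Z)| = l1 by [].
  apply: Vc => //; first exact: subset_trans (first_jobs_sub _ _) JK.
  by apply: goodS gJ'; apply: first_jobs_sub.
have tE := total_first (weight I) J' (R a + p * l1%:Z).
have cE' := card_rest J' (R a + p * l1%:Z); rewrite eE -/i in cE'.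
have [E0|E0] := eqVneq (J' :\: first_jobs J' (R a + p * l1%:Z)) set0.
  rewrite E0 cards0 addn0 in cE'; rewrite E0 total0 addr0 in tE.
  have rl : r k <= R a + p * i%:Z by rewrite cE'.
  by have := A1 rl; rewrite cE cE'; lia.
have [b bn [RJ2 Rj]] := min_release E0.
have tb : R a + p * l1%:Z <= R b by case: Rj => j jJ <-; apply: rest_ge jJ.
have J2gt0 : (0 < #|J' :\: first_jobs J' (R a + p * l1%:Z)|)%N by rewrite card_gt0.
have l1lt : (l1 < i)%N by lia.
have tk : tick k a b l1.
  apply/and3P; split => //; rewrite ltNge; apply/negP => le2.
  have := hc l1.+1 isT l1lt; rewrite lenS addrA.
  have := leq_early J' le2; rewrite (early_rest J' tb) eE (early0 RJ2) => e1 e2.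
  by have := leq_trans e2 e1; rewrite addn0 ltnn.
have l1n : (l1 <= n)%N by lia.
have [Tb _] := Tc b l1 bn l1n tk.
suff : weight I k + (T b + w (J' :\: first_jobs J' (R a + p * l1%:Z))) <= A a i.+1.
  by rewrite cE; lia.
apply: (@chain_complete K k a v _ i.+1 T _ b l1) => //.
- by apply: subset_trans JK; apply: subsetDl.
- by apply: goodS gJ'; apply: subsetDl.
- by rewrite cE'.
move=> l' l1l' l'i; have := hc l' ltac:(lia) ltac:(lia).
have tl : R a + p * l1%:Z <= R a + p * l'%:Z by rewrite lerD2l len_leM // ltnW.
rewrite (early_rest J' tl) eE; lia.
Qed.

(** Cut off the first prime piece. If it contains [k], [A] bounds it and the old table bounds the
    rest; otherwise the old table bounds it and the rest is covered by induction on the size. *)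
Lemma block_complete_step K k v A v' : block_complete K v ->
  insert_table k v A -> join_table v A v' ->
  (forall j, j \in K -> d j <= d k) -> block_complete (k |: K) v'.
Proof.
move=> Vc iA jA Kk J; elim: {J}_.+1 {-2}J (ltnSn #|J|) => // sz IH J Jsz a.
move=> an JK gJ cJ.
have v_le i : (i <= n)%N -> v a i <= v' a i by move=> /((jA a an).1 _)[].
have [kJ|kJ] := boolP (k \in J); last first.
  apply: (le_trans _ (v_le _ (card_le_n _))); apply: Vc => //.
  apply/subsetP => j jJ; have := subsetP JK _ jJ; rewrite !inE => /predU1P[jk|//].
  by rewrite -jk jJ in kJ.
have JkK (J' : {set 'I_n}) : J' \subset J -> J' :\ k \subset K.
  move=> sJ; apply/subsetP => j; rewrite !inE => /andP[jk /(subsetP sJ)].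
  by move=> /(subsetP JK); rewrite !inE (negbTE jk).
have J0 : J != set0 by apply/set0Pn; exists k.
have [g /= [g0 cg c1 p1]] := first_block cJ.1 (compact_start cJ J0).
set t := R a + p * g%:Z in cg c1 p1.
have eg : early J t = g by [].
have tE := total_first (weight I) J t; have cE := card_rest J t.
have c2 := compact_rest cJ eg; rewrite -/t in c2.
have g1 : good (first_jobs J t) by apply: goodS gJ; apply: first_jobs_sub.
have g2 : good (J :\: first_jobs J t) by apply: goodS gJ; apply: subsetDl.
have gn : (g <= n)%N by rewrite -cg card_le_n.
have wA : k \in first_jobs J t -> w (first_jobs J t) <= A a g.
  move=> k1; rewrite -cg; apply: (insert_complete Vc iA Kk) => //.
  by apply: JkK; apply: first_jobs_sub.
have [E0|E0] := eqVneq (J :\: first_jobs J t) set0.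
  rewrite E0 total0 addr0 in tE; rewrite E0 cards0 addn0 eg in cE.
  rewrite tE cE; apply: (le_trans (wA _)).
    by rewrite -(first_jobsU J t) E0 setU0 in kJ.
  by apply: ((jA a an).1 _ gn).2.
have [j2 j2J Rj2] := compact_start c2 E0.
have [b bn Rb] := R_release j2.
have tb : t = R b by rewrite Rb.
have ab : R a < R b by have := len_leM g0; rewrite -tb /t; lia.
have [vj Aj] := (jA a an).2 b g #|J :\: first_jobs J t| bn ab tb
  ltac:(by have := card_le_n J; lia).
rewrite eg in cE; rewrite cE tE.
have [k1|k1] := boolP (k \in first_jobs J t).
  suff : w (J :\: first_jobs J t) <= v' b #|J :\: first_jobs J t|.
    by have := wA k1; lia.
  apply: (le_trans _ ((jA b bn).1 _ (card_le_n _)).1); apply: Vc => //; last by rewrite -tb.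
  apply: subset_trans (JkK _ (subxx _)); apply/subsetP => j.
  move=> jJ; rewrite !inE; have := jJ; rewrite !inE => /andP[_ ->]; rewrite andbT.
  by apply/eqP => jk; move: jJ; rewrite jk inE k1.
have : w (J :\: first_jobs J t) <= v' b #|J :\: first_jobs J t|.
  apply: IH => //; [by lia| |by rewrite -tb].
  by apply: subset_trans JK; apply: subsetDl.
suff : w (first_jobs J t) <= v a g by lia.
rewrite -cg; apply: Vc => //; apply: subset_trans (JkK _ (first_jobs_sub J t)).
by apply/subsetP => j jJ; rewrite in_setD1 jJ andbT; apply/eqP => jk; rewrite -jk jJ in k1.
Qed.

(** Idle time between the blocks is unrestricted here, so no number of jobs has to be determined by
    the end point. *)
Definition final_table (v : nat -> nat -> int) (W : nat -> int) : Prop :=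
  forall b, (b <= n)%N -> 0 <= W b /\ forall b' i, (b' < b)%N -> (i <= n)%N ->
    R b' + p * i%:Z <= R b -> W b' + v b' i <= W b.

Lemma final_complete v W J : block_complete setT v -> final_table v W ->
  good J -> w J <= W n.
Proof.
move=> Vc Wc gJ.
have [->|J0] := eqVneq J set0; first by rewrite total0; exact: (Wc n _).1.
have [b bn [RJ Rj]] := min_release J0.
suff : W b + w J <= W n by have [] := Wc b (ltnW bn); lia.
elim: {J}_.+1 {-2}J (ltnSn #|J|) gJ J0 b bn RJ Rj => // sz IH J Jsz gJ J0 b bn RJ Rj.
have dJ : done_by J (R n).
  suff E : due J (R n) = J by rewrite -E; exact: gJ.
  by apply/setP => j; rewrite inE R_last andbT.
have [g /= [g0 cg c1 _]] := first_block RJ Rj.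
set t := R b + p * g%:Z in cg c1.
have tE := total_first (weight I) J t; have cE := card_rest J t.
have eg : early J t = g by [].
have g1 : good (first_jobs J t) by apply: goodS gJ; apply: first_jobs_sub.
have v1 : w (first_jobs J t) <= v b g by rewrite -cg; apply: Vc.
have gn : (g <= n)%N by rewrite -cg card_le_n.
have [E0|E0] := eqVneq (J :\: first_jobs J t) set0.
  rewrite E0 total0 addr0 in tE; rewrite E0 cards0 addn0 eg in cE.
  have tn : R b + p * g%:Z <= R n by rewrite -cE; apply: done_by_card.
  by have := (Wc n (leqnn n)).2 b g bn gn tn; lia.
have [b2 b2n [RJ2 [j2 j2J2 Rj2]]] := min_release E0.
have tb2 : t <= R b2 by rewrite -Rj2; apply: rest_ge j2J2.
have bb2 : (b < b2)%N by apply: R_lt => //; have := len_leM g0; rewrite /t in tb2; lia.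
have := (Wc b2 (ltnW b2n)).2 b g bb2 gn tb2.
suff : W b2 + w (J :\: first_jobs J t) <= W n by lia.
apply: IH => //; [by lia| |by exists j2].
by apply: goodS gJ; apply: subsetDl.
Qed.

(** * Soundness: table entries belong to feasible sets *)

(** The set has to fit but not to be busy; [i] only bounds the number of its jobs. The empty set is
    always admissible, which justifies the initial value 0. *)
Definition block_set K a (i : nat) J : Prop :=
  [/\ J \subset K, good J, forall j, j \in J -> R a <= r j
    & done_by J (R a + p * i%:Z)].

(* The last clause leaves room for k: next to J, job k still fits into every
   [x, R a + p (m + 1)) with x <= r_k. *)
Definition chain_set K k a b (m : nat) J : Prop :=
  [/\ J \subset K, good J, forall j, j \in J -> R a <= r j, done_by J (R b)
    & forall x, x <= r k -> x + p * (late J x)%:Z <= R a + p * m%:Z].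

Lemma block_set0 K a i : block_set K a i set0.
Proof.
split; [exact: sub0set|exact: good0| |exact: done_by0].
by move=> j; rewrite inE.
Qed.

Lemma block_setS K K' a i J : K \subset K' -> block_set K a i J ->
  block_set K' a i J.
Proof. by move=> sK [JK gJ RJ dJ]; split=> //; apply: subset_trans sK. Qed.

Lemma chain_set_base K k a b (m : nat) J : tick k a b m -> block_set K a m J ->
  chain_set K k a b m J.
Proof.
case/and3P => t1 t2 t3 [JK gJ RJ dJ]; split => //.
  exact: done_by_le dJ.
move=> x xk; have [->|l0] := posnP (late J x); last exact: dJ.
by rewrite mulr0 addr0; lia.
Qed.

(** The room for [k] survives because [J2] fits into [m - m'] job lengths and so has at most
    [m - m'] jobs, exactly the growth of the right-hand side. *)
Lemma chain_set_step K k a b b' (m m' : nat) J1 J2 :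
  (m' <= m)%N -> tick k a b m -> tick k a b' m' ->
  R b' + p * (m - m')%N%:Z <= R b ->
  chain_set K k a b' m' J1 -> block_set K b' (m - m') J2 ->
  [disjoint J1 & J2] /\ chain_set K k a b m (J1 :|: J2).
Proof.
move=> mm /and3P[t1 t2 t3] /and3P[u1 u2 u3] bb [J1K g1 R1 d1 s1] [J2K g2 R2 d2].
have bb' : R b' <= R b.
  by apply: le_trans bb; rewrite lerDl mulr_ge0 //; lia.
have dis := disjoint_release d1 R2.
split=> //; split.
- by rewrite subUset J1K.
- exact: goodU d1 g1 R2 g2.
- move=> j; rewrite inE => /orP[/R1//|/R2]; apply: le_trans; apply: le_trans u1.
  by rewrite lerDl mulr_ge0 //; lia.
- by apply: (done_byU d1 _ R2); [exact: done_by_le d1|exact: done_by_le d2].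
move=> x xk; rewrite lateU // PoszD mulrDr.
have : (late J2 x <= m - m')%N.
  apply: leq_trans (done_by_card_le R2 d2).
  by have := late_early J2 x; lia.
move=> /len_leM; have := s1 _ xk.
have : p * (m - m')%N%:Z = p * m%:Z - p * m'%:Z by rewrite -mulrBr subzn.
by lia.
Qed.

(** The bound on [late J x] for [x <= r k] leaves [p] units for [k] before the end of the block, and
    that end is no later than [d k]. *)
Lemma insert_set K k a (i : nat) J : k \notin K ->
  (forall j, j \in K -> d j <= d k) -> R a <= r k ->
  R a + p * i%:Z + p <= d k ->
  J \subset K -> good J -> (forall j, j \in J -> R a <= r j) ->
  done_by J (R a + p * i%:Z + p) ->
  (forall x, x <= r k -> x + p * (late J x)%:Z <= R a + p * i%:Z) ->
  k \notin J /\ block_set (k |: K) a i.+1 (k |: J).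
Proof.
move=> kK Kk ak dk JK gJ RJ dJ sJ.
have kJ : k \notin J by apply: contra kK => /(subsetP JK).
have dJk : done_by (k |: J) (R a + p * i%:Z + p).
  by apply: done_by_add => // x /sJ; lia.
split=> //; split.
- exact: setUS.
- by apply: (good_add gJ _ dJk) => // j /(subsetP JK) /Kk.
- by move=> j; rewrite !inE => /predU1P[->|/RJ].
- by rewrite -addn1 PoszD mulrDr mulr1 addrA.
Qed.

Lemma insert_set_base K k a (i : nat) J : k \notin K ->
  (forall j, j \in K -> d j <= d k) -> R a <= r k ->
  R a + p * i%:Z + p <= d k -> r k <= R a + p * i%:Z ->
  block_set K a i J -> k \notin J /\ block_set (k |: K) a i.+1 (k |: J).
Proof.
move=> kK Kk ak dk rk [JK gJ RJ dJ]; apply: insert_set => //.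
  by apply: done_by_le dJ; lia.
move=> x xk; have [->|l0] := posnP (late J x); last exact: dJ.
by rewrite mulr0 addr0; lia.
Qed.

Lemma insert_set_chain K k a b (i m : nat) J1 J2 : k \notin K ->
  (forall j, j \in K -> d j <= d k) -> R a <= r k ->
  R a + p * i%:Z + p <= d k -> (m <= i)%N -> tick k a b m ->
  chain_set K k a b m J1 -> block_set K b (i - m) J2 ->
  [/\ [disjoint J1 & J2], k \notin J1 :|: J2 &
      block_set (k |: K) a i.+1 (k |: (J1 :|: J2))].
Proof.
move=> kK Kk ak dk mi /and3P[t1 t2 t3] [J1K g1 R1 d1 s1] [J2K g2 R2 d2].
have dis := disjoint_release d1 R2.
have pE : p * (i - m)%N%:Z = p * i%:Z - p * m%:Z by rewrite -mulrBr subzn.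
have pmi := len_leM mi.
have ab : R a <= R b by apply: le_trans t1; rewrite lerDl mulr_ge0 //; lia.
suff [] : k \notin J1 :|: J2 /\ block_set (k |: K) a i.+1 (k |: (J1 :|: J2)) by [].
apply: insert_set => //.
- by rewrite subUset J1K.
- exact: goodU d1 g1 R2 g2.
- by move=> j; rewrite inE => /orP[/R1//|/R2]; apply: le_trans.
- apply: (done_byU d1 _ R2); [apply: done_by_le d1|apply: done_by_le d2]; lia.
move=> x xk; rewrite lateU // PoszD mulrDr.
have : (late J2 x <= i - m)%N.
  apply: leq_trans (done_by_card_le R2 d2).
  by have := late_early J2 x; lia.
move=> /len_leM; have := s1 _ xk; lia.
Qed.

Lemma join_set K a b (m i : nat) J1 J2 : R a + p * m%:Z = R b ->
  block_set K a m J1 -> block_set K b i J2 ->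
  [disjoint J1 & J2] /\ block_set K a (m + i) (J1 :|: J2).
Proof.
move=> ab [J1K g1 R1 d1] [J2K g2 R2 d2]; rewrite ab in d1.
have dis := disjoint_release d1 R2; split=> //; split.
- by rewrite subUset J1K.
- exact: goodU d1 g1 R2 g2.
- move=> j; rewrite inE => /orP[/R1//|/R2]; apply: le_trans.
  by rewrite -ab lerDl mulr_ge0 //; lia.
- rewrite PoszD mulrDr addrA ab; apply: (done_byU d1 _ R2) => //.
  by apply: done_by_le d1; rewrite lerDl mulr_ge0 //; lia.
Qed.

Definition final_set b J : Prop := good J /\ done_by J (R b).

Lemma final_set0 b : final_set b set0.
Proof. by split; [exact: good0|exact: done_by0]. Qed.

Lemma final_set_step K b b' i J1 J2 : R b' + p * i%:Z <= R b ->
  final_set b' J1 -> block_set K b' i J2 ->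
  [disjoint J1 & J2] /\ final_set b (J1 :|: J2).
Proof.
move=> bb [g1 d1] [J2K g2 R2 d2].
have dis := disjoint_release d1 R2; split=> //; split.
  exact: goodU d1 g1 R2 g2.
have b'b : R b' <= R b by apply: le_trans bb; rewrite lerDl mulr_ge0 //; lia.
by apply: (done_byU d1 _ R2); [apply: done_by_le d1|apply: done_by_le d2].
Qed.

End Sets.

(** * Schedules and the earliest-deadline rule *)

Section Schedules.

Variables (n : nat) (I : jobs n).
Hypothesis len_gt0 : 1 <= len I.

Implicit Types (J : {set 'I_n}) (S : assignment n) (x y t : int).

Notation p := (len I).
Notation r := (release I).
Notation d := (deadline I).

(** * Counting time units; necessity of the Hall condition *)

Definition units S j t : nat := #|` [fset u in S j | u < t]%fset|.

Lemma fset_max (A : {fset int}) : A != fset0 ->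
  exists2 t, t \in A & forall u, u \in A -> u <= t.
Proof.
case/fset0Pn => t0 t0A.
have : t0 \in enum_fset A by [].
suff H (s : seq int) t : t \in s -> exists2 t, t \in s & forall u, u \in s -> u <= t.
  by move=> /H.
elim: s t => //= a [_ t _|b s IH t _].
  by exists a; [exact: mem_head|move=> u; rewrite inE => /eqP ->].
have [c cs cmax] := IH b (mem_head _ _).
case: (lerP a c) => ac.
  by exists c; [rewrite inE cs orbT|move=> u; rewrite inE => /predU1P[->|/cmax]].
exists a; first exact: mem_head.
by move=> u; rewrite inE => /predU1P[->//|/cmax uc]; rewrite (le_trans uc) // ltW.
Qed.

(** In this form the units of a job can be summed over jobs and the sums exchanged; capacity is
    counted this way in both directions of the Hall theorem. *)
Lemma card_fset_interval (A : {fset int}) x (m : nat) :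
  (forall t, t \in A -> x <= t < x + m%:Z) ->
  #|` A| = (\sum_(i < m) ((x + i%:Z)%R \in A))%N.
Proof.
move=> hA; pose s := [seq t <- [seq x + (i : nat)%:Z | i <- iota 0 m] | t \in A].
have /perm_size -> : perm_eq (enum_fset A) s.
  apply: uniq_perm; first exact: fset_uniq.
    rewrite filter_uniq // map_inj_uniq ?iota_uniq // => i j /addrI; by case.
  move=> t; rewrite mem_filter; case: (boolP (t \in A)) => //= tA.
  symmetry; apply/mapP; exists `|t - x|%N; last by have := hA t tA; lia.
  by rewrite mem_iota; have := hA t tA; lia.
rewrite /s size_filter count_map -sum1_count big_mkcond /=.
rewrite -{1}(subn0 m) -/(index_iota 0 m) big_mkord.
by apply: eq_bigr => i _; case: (_ \in _).
Qed.

Lemma leq_units S j t t' : t <= t' -> (units S j t <= units S j t')%N.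
Proof.
move=> tt'; apply/fsubset_leq_card/fsubsetP => u; rewrite !inE /=.
by case/andP => -> ut; apply: lt_le_trans tt'.
Qed.

Definition disjoint_units S : Prop :=
  forall i j, i != j -> [disjoint S i & S j]%fset.

Lemma sum_unit_le1 S J t : disjoint_units S -> (\sum_(j in J) (t \in S j) <= 1)%N.
Proof.
move=> dS; have [/existsP[j0 /andP[j0J tj0]]|] := boolP [exists j, (j \in J) && (t \in S j)].
  rewrite (bigD1 j0) //= big1 ?addn0; first by case: (_ \in _).
  move=> j /andP[jJ jj0]; have /fdisjointP/(_ t) := dS _ _ jj0.
  by case: (t \in S j) => // /(_ isT); rewrite tj0.
rewrite negb_exists => /forallP hn; rewrite big1 // => j jJ.
by have := hn j; rewrite jJ /= => /negbTE ->.
Qed.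

(** The jobs released at [x] or later and due by [y] take [p] units each inside [[x, y)], and no
    unit is used twice. *)
Lemma feasible_good J : feasible I J -> good I J.
Proof.
move=> [S [Sw Sd] Sc] y x l0.
pose Q := [set j in due I J y | x <= r j].
have QE : late I (due I J y) x = #|Q| by [].
have cS j : j \in Q -> (#|` S j|)%:Z = p.
  by rewrite !inE => /andP[/andP[jJ _] _]; apply/eqP/Sc.
have wS j t : j \in Q -> t \in S j -> x <= t < y.
  rewrite !inE => /andP[/andP[_ dy] xr] /Sw /andP[rt td].
  by rewrite (le_trans xr rt) (lt_le_trans td dy).
(* Ensures that the absolute value [m] below is the length of the interval. *)
have xy : x < y.
  case/card_gt0P: (l0) => j; rewrite -/Q => jQ.
  have : #|` S j|%fset != 0%N by have := cS j jQ; lia.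
  by rewrite cardfs_eq0 => /fset0Pn[t /(wS _ _ jQ)]; lia.
pose m := `|(y - x)%R|%N.
have mE : m%:Z = y - x by rewrite /m; lia.
suff : p * #|Q|%:Z <= m%:Z by rewrite QE; lia.
have -> : p * #|Q|%:Z = (\sum_(j in Q) #|` S j|%fset)%N%:Z.
  rewrite -sum1_card (big_morph Posz PoszD (erefl _)).
  rewrite [in RHS](big_morph Posz PoszD (erefl _)) mulr_sumr.
  by apply: eq_bigr => j /cS ->; rewrite mulr1.
rewrite lez_nat.
have -> : (\sum_(j in Q) #|` S j|%fset =
           \sum_(i < m) \sum_(j in Q) ((x + i%:Z)%R \in S j))%N.
  rewrite exchange_big /=; apply: eq_bigr => j jQ.
  by apply: card_fset_interval => t /(wS _ _ jQ); rewrite mE; lia.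
rewrite -[X in (_ <= X)%N](card_ord m) -sum1_card; apply: leq_sum => i _.
exact: sum_unit_le1.
Qed.

(** * Earliest-deadline schedules of good sets *)

(** The rule is imposed before [y] only, so that a schedule can be built unit by unit. *)
Definition edf_before J S y : Prop :=
  [/\ disjoint_units S,
      forall j t, t < y -> t \in S j -> pending I J S j t /\
        forall i, pending I J S i t -> d j <= d i
    & forall i t, t < y -> pending I J S i t -> exists j, t \in S j].

(** At its last unit before [t] the job was still pending, hence had received fewer than [p]
    units. *)
Lemma units_le J S y j t : edf_before J S y -> t <= y -> (units S j t)%:Z <= p.
Proof.
move=> [_ eS _] ty; have [E|] := eqVneq [fset u in S j | u < t]%fset fset0.
  by rewrite /units E cardfs0; lia.
case/fset_max => s; rewrite !inE /= => /andP[sS st] smax.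
have [/and3P[_ _ us] _] := eS j s (lt_le_trans st ty) sS.
suff : (units S j t <= 1 + units S j s)%N by move: us; rewrite -/(units S j s); lia.
rewrite {1}/units (cardfsD1 s) leq_add //; first by case: (_ \in _).
apply/fsubset_leq_card/fsubsetP => u; rewrite !inE /= => /andP[us' /andP[uS ut]].
by rewrite uS /= lt_neqAle us' smax // !inE /= uS.
Qed.

Lemma last_idle (busy : int -> bool) x y : x <= y -> ~~ busy (x - 1) ->
  exists2 z, z <= y & ~~ busy (z - 1) /\ forall t, z <= t < y -> busy t.
Proof.
move=> xy nb; pose P k := ~~ busy (y - k%:Z - 1).
have exP : exists k, P k.
  by exists `|(y - x)%R|%N; rewrite /P (_ : y - _ - 1 = x - 1) //; lia.
case: (ex_minnP exP) => k Pk kmin; exists (y - k%:Z); first by lia.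
split=> // t ty; have : ~~ P `|(y - t - 1)%R|%N by apply/negP => /kmin; lia.
by rewrite /P negbK (_ : y - _ - 1 = t) //; lia.
Qed.

Lemma release_lb J : exists x, forall j, j \in J -> x <= r j.
Proof.
exists (- \sum_j `|r j|) => j _; rewrite (bigD1 j) //=.
rewrite lerNl (@le_trans _ _ `|r j|) //; first by rewrite -normrN ler_norm.
by rewrite lerDl sumr_ge0.
Qed.

(** Suppose [j] is short at [d j]. Let [[x, d j)] be the maximal interval ending there in which some
    job due by [d j] is always pending. The machine spends all of it on jobs due by [d j] and
    released at [x] or later; each gets at most [p] units and [j] fewer, so the interval is too
    short for them, against the Hall condition. *)
Lemma edf_in_time J S y j : good I J -> edf_before J S y -> j \in J ->
  d j <= y -> p <= (units S j (d j))%:Z.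
Proof.
move=> gJ eJ jJ jy; rewrite leNgt; apply/negP => uj.
have [dS eS bS] := eJ.
have jD : j \in due I J (d j) by rewrite inE jJ lexx.
have rd : r j <= d j.
  by apply: ltW; exact: (done_by_release len_gt0 (gJ _) jD).
pose busy t := [exists i, (d i <= d j) && pending I J S i t].
have [x0 hx0] := release_lb J.
have nb0 : ~~ busy (x0 - 1).
  apply/existsP => [[i /andP[_ /and3P[/hx0 x0i ri _]]]]; lia.
have x0d : x0 <= d j by rewrite (le_trans (hx0 j jJ)).
have [x xd [nb hb]] := last_idle x0d nb0.
pose Q := [set i in due I J (d j) | x <= r i].
(* Had such a job been released before [x], it would have been pending at [x - 1]. *)
have late_pending i t : d i <= d j -> pending I J S i t -> x <= t -> x <= r i.
  move=> di /and3P[iJ rt ut] xt; rewrite leNgt; apply/negP => ri.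
  case/negP: nb; apply/existsP; exists i; rewrite di /= /pending iJ /=.
  apply/andP; split; first by lia.
  apply: le_lt_trans ut; rewrite lez_nat; apply: leq_units; lia.
have jx : x <= r j.
  have xj : x - 1 <= d j by lia.
  rewrite leNgt; apply/negP => rj; case/negP: nb; apply/existsP; exists j.
  rewrite lexx /= /pending jJ /=; apply/andP; split; first by lia.
  by apply: le_lt_trans uj; rewrite lez_nat; apply: leq_units.
have jQ : j \in Q by rewrite inE jD jx.
have l0 : (0 < late I (due I J (d j)) x)%N by apply/late_gt0P; exists j.
have := gJ (d j) x l0; rewrite -[late _ _ _]/#|Q|.
pose m := `|(d j - x)%R|%N.
have mE : m%:Z = d j - x by rewrite /m; lia.
suff : m%:Z < p * #|Q|%:Z by lia.
pose U i := [fset u in S i | (x <= u) && (u < d j)]%fset.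
have UE i : #|` U i| = (\sum_(l < m) ((x + l%:Z)%R \in S i))%N.
  rewrite (@card_fset_interval _ x m).
    apply: eq_bigr => l _; rewrite !inE /=; case: (_ \in _) => //=.
    by have := ltn_ord l; rewrite -ltz_nat mE => lm; apply/eqP; rewrite eqb1; lia.
  by move=> t; rewrite !inE /= mE => /andP[_]; lia.
have Uu i : (#|` U i| <= units S i (d j))%N.
  apply/fsubset_leq_card/fsubsetP => u; rewrite !inE /=.
  by case/andP => -> /andP[_ ->].
have : (m <= \sum_(i in Q) #|` U i|)%N.
  under eq_bigr => i _ do rewrite UE.
  rewrite exchange_big /= -[X in (X <= _)%N](card_ord m) -sum1_card.
  apply: leq_sum => l _; have lm := ltn_ord l; rewrite -ltz_nat mE in lm.
  have xl : x <= x + l%:Z by lia.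
  have lyj : x + l%:Z < d j by lia.
  have /hb/existsP[i /andP[di pi]] : x <= x + l%:Z < d j by rewrite xl.
  have ly : x + l%:Z < y by lia.
  have [i' Si'] := bS i _ ly pi.
  have [pi' /(_ _ pi) di'] := eS _ _ ly Si'.
  have di2 : d i' <= d j := le_trans di' di.
  have i'Q : i' \in Q.
    by case/and3P: (pi') => iJ _ _; rewrite !inE iJ di2 (late_pending _ _ di2 pi' xl).
  by rewrite (bigD1 i') //= Si'.
move=> mQ; apply: (@le_lt_trans _ _ (\sum_(i in Q) #|` U i|)%N%:Z); first by rewrite lez_nat.
rewrite (big_morph Posz PoszD (erefl _)).
rewrite -sum1_card (big_morph Posz PoszD (erefl _)) mulr_sumr.
rewrite (bigD1 j) //= [X in _ < X](bigD1 j) //=; apply: ltr_leD.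
  by rewrite mulr1; apply: le_lt_trans uj; rewrite lez_nat.
apply: ler_sum => i _; rewrite mulr1; apply: le_trans (units_le i eJ jy).
by rewrite lez_nat.
Qed.

Lemma edf_prefix J x (m : nat) : (forall j, j \in J -> x <= r j) ->
  exists S, (forall j t, t \in S j -> t < x + m%:Z) /\ edf_before J S (x + m%:Z).
Proof.
move=> xJ; elim: m => [|m [S [wS [dS eS bS]]]].
  exists (fun=> fset0); split=> //; split=> //.
    by move=> i j _; apply: fdisjoint0X.
  move=> i t; rewrite addr0 => tx /and3P[/xJ]; lia.
pose T := x + m%:Z; rewrite -/T in wS eS bS.
have TE : x + m.+1%:Z = T + 1 by rewrite /T; lia.
rewrite TE; case: (pickP (fun i => pending I J S i T)) => [i0 pi0|none]; last first.
  exists S; split; first by move=> j t /wS; lia.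
  split=> // [j t _ tS|i t tT]; first by apply: eS (wS _ _ tS) tS.
  have [tT'|Tt] := ltrP t T; first exact: bS.
  by rewrite (_ : t = T) ?none //; lia.
case: (@Order.TotalTheory.arg_minP _ _ _ i0 (fun i => pending I J S i T) d pi0) => k pk kmin.
pose S' j := if j == k then (T |` S j)%fset else S j.
have S'E j t : (t \in S' j) = ((j == k) && (t == T)) || (t \in S j).
  by rewrite /S'; case: eqP => //= _; rewrite !inE.
(* Being pending at [t <= T] depends only on units before [T], where the two assignments agree. *)
have pE i t : t <= T -> pending I J S' i t = pending I J S i t.
  move=> tT; rewrite /pending; congr [&& _, _ & (#|` _|)%:Z < _].
  apply/fsetP => u; rewrite !inE /= S'E; case: (ltrP u t); rewrite ?andbF // => ut.
  by rewrite (_ : (u == T) = false) ?andbF //; apply/eqP; lia.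
exists S'; split.
  by move=> j t; rewrite S'E => /orP[/andP[_ /eqP ->]|/wS]; lia.
split.
- move=> i j ij; apply/fdisjointP => t; rewrite !S'E.
  case/orP => [/andP[/eqP ik /eqP tT]|ti].
    rewrite -ik eq_sym (negbTE ij) /= tT; apply/negP => /wS; lia.
  have := wS _ _ ti; rewrite negb_or => tT.
  rewrite (_ : (t == T) = false) ?andbF /=; last by apply/eqP; lia.
  by have /fdisjointP/(_ t ti) := dS _ _ ij.
- move=> j t tT; rewrite S'E => /orP[/andP[/eqP -> /eqP ->]|tj].
    by rewrite pE //; split=> // i; rewrite pE //; apply: kmin.
  have tT' := wS _ _ tj; have [pj jmin] := eS j t tT' tj.
  by rewrite (pE _ _ (ltW tT')); split=> // i; rewrite (pE _ _ (ltW tT')); apply: jmin.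
move=> i t tT; have tT2 : t <= T by [lia]; rewrite (pE _ _ tT2) => pi.
have [tT'|Tt] := ltrP t T.
  by have [j tj] := bS _ _ tT' pi; exists j; rewrite S'E tj orbT.
by exists k; rewrite S'E eqxx /=; apply/orP; left; apply/eqP; lia.
Qed.

Lemma edf_before_all J S y : edf_schedule I J S -> edf_before J S y.
Proof. by move=> [dS eS bS]; split=> // [j t _|i t _]; [apply: eS|apply: bS]. Qed.

Lemma pending_in_time J S y j t : good I J -> edf_before J S y -> d j <= y ->
  pending I J S j t -> t < d j.
Proof.
move=> gJ eJ jy /and3P[jJ _ ut]; rewrite ltNge; apply/negP => dt.
have := edf_in_time gJ eJ jJ jy; have := leq_units S j dt.
by rewrite /units in ut *; lia.
Qed.

Lemma good_edf J : good I J -> exists S, edf_schedule I J S.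
Proof.
move=> gJ; have [x hx] := release_lb J.
(* The point [x + m] is no earlier than any deadline. Nothing is pending from then on, so the prefix
   is already a complete schedule. *)
pose m := (\sum_j `|(d j - x)%R|)%N.
have [S [wS eJ]] := edf_prefix m hx; exists S.
have dy j : d j <= x + m%:Z.
  by rewrite /m (bigD1 j) //=; lia.
have [dS eS bS] := eJ; split=> // [j t tj|i t pi]; first by apply: eS (wS _ _ tj) tj.
by apply: (bS i) => //; have := pending_in_time gJ eJ (dy i) pi; have := dy i; lia.
Qed.

Lemma edf_good J S : good I J -> edf_schedule I J S ->
  is_schedule I S /\ forall j, completes I S j = (j \in J).
Proof.
move=> gJ eJ; have [dS eS bS] := eJ.
have wS j t : t \in S j -> [/\ j \in J, r j <= t & t < d j].
  move=> tj; have [pj _] := eS _ _ tj; case/and3P: (pj) => jJ rt _; split=> //.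
  exact: pending_in_time gJ (edf_before_all (d j) eJ) (lexx _) pj.
split; first by split=> // j t /wS[_ -> ->].
move=> j; rewrite /completes; case: (boolP (j \in J)) => jJ; last first.
  rewrite (_ : S j = fset0) ?cardfs0; first by apply/eqP; lia.
  by apply/eqP; apply/negPn/negP => /fset0Pn[t /wS[]]; rewrite (negbTE jJ).
have -> : #|` S j|%fset = units S j (d j).
  congr #|` _|; apply/fsetP => t; rewrite !inE /=; case: (boolP (t \in S j)) => //.
  by case/wS => _ _ ->.
have := edf_in_time gJ (edf_before_all (d j) eJ) jJ (lexx _).
have := units_le j (edf_before_all (d j) eJ) (lexx _).
by move=> *; apply/eqP; lia.
Qed.

Lemma best_good_optimal J : good I J ->
  (forall J', good I J' -> set_weight I J' <= set_weight I J) ->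
  [/\ max_weight_feasible I J, exists S, edf_schedule I J S &
      forall S, edf_schedule I J S -> optimal_schedule I S].
Proof.
move=> gJ best; split; last 1 first.
- move=> S eS; have [sS cS] := edf_good gJ eS; split=> // S' sS'.
  have -> : throughput I S = set_weight I J by apply: eq_bigl => j; rewrite cS.
  have -> : throughput I S' = set_weight I [set j | completes I S' j].
    by apply: eq_bigl => j; rewrite inE.
  by apply/best/feasible_good; exists S' => // j; rewrite inE.
- split; last by move=> J' /feasible_good /best.
  have [S eS] := good_edf gJ; have [sS cS] := edf_good gJ eS.
  by exists S => // j; rewrite cS.
exact: good_edf.
Qed.

End Schedules.

(** * Programs with bounded loops *)

(** With counted loops only, termination is structural: the semantics [run] is a function, and cost
    bounds can be read off the syntax. *)
Inductive prg :=
| PSkip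
| PSet of nat & expr
| PStore of nat & expr & expr
| PSeq of prg & prg
| PIf of test & prg & prg
| PFor of nat & nat & prg.

Fixpoint compile (c : prg) : cmd :=
  match c with
  | PSkip => Skip
  | PSet x e => Assign x e
  | PStore a e1 e2 => Write a e1 e2
  | PSeq c1 c2 => Seq (compile c1) (compile c2)
  | PIf b c1 c2 => If b (compile c1) (compile c2)
  | PFor x y c1 => Seq (Assign x (Const 0))
      (While (Not (Le (Var y) (Var x)))
        (Seq (compile c1) (Assign x (Add (Var x) (Const 1)))))
  end.

Fixpoint run (c : prg) (s : store) : store :=
  match c with
  | PSkip => s
  | PSet x e => set_var s x (eval s e)
  | PStore a e1 e2 => set_arr s a (eval s e1) (eval s e2)
  | PSeq c1 c2 => run c2 (run c1 s)
  | PIf b c1 c2 => if eval_test s b then run c1 s else run c2 s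
  | PFor x y c1 =>
      iter `|var s y|%N
        (fun s' => set_var (run c1 s') x (var (run c1 s') x + 1))
        (set_var s x 0)
  end.

Fixpoint modv (c : prg) : seq nat :=
  match c with
  | PSkip | PStore _ _ _ => [::]
  | PSet x _ => [:: x]
  | PSeq c1 c2 | PIf _ c1 c2 => modv c1 ++ modv c2
  | PFor x _ c1 => x :: modv c1
  end.

Fixpoint moda (c : prg) : seq nat :=
  match c with
  | PSkip | PSet _ _ => [::]
  | PStore a _ _ => [:: a]
  | PSeq c1 c2 | PIf _ c1 c2 => moda c1 ++ moda c2
  | PFor _ _ c1 => moda c1
  end.

(* Variables 0 and 2 are the only loop bounds (they hold n and n + 1), and are
   never assigned. *)
Definition bounds : seq nat := [:: 0; 2]%N.

Fixpoint well_formed (c : prg) : bool :=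
  match c with
  | PSkip | PStore _ _ _ => true
  | PSet x _ => x \notin bounds
  | PSeq c1 c2 | PIf _ c1 c2 => well_formed c1 && well_formed c2
  | PFor x y c1 =>
      [&& x \notin bounds, y \in bounds, x \notin modv c1 & well_formed c1]
  end.

Fixpoint depth (c : prg) : nat :=
  match c with
  | PSeq c1 c2 | PIf _ c1 c2 => maxn (depth c1) (depth c2)
  | PFor _ _ c1 => (depth c1).+1
  | _ => 0
  end.

(** In a loop, testing and incrementing cost 9 steps per iteration; initialisation and the last test
    cost 7 once. Together they give 16. *)
Fixpoint coef (c : prg) : nat :=
  match c with
  | PSkip => 1
  | PSet _ e => (expr_cost e).+1
  | PStore _ e1 e2 => (expr_cost e1 + expr_cost e2).+1
  | PSeq c1 c2 => coef c1 + coef c2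
  | PIf b c1 c2 => (test_cost b + (coef c1 + coef c2)).+1
  | PFor _ _ c1 => coef c1 + 16
  end.

(** * Frame conditions and running time *)

Definition agree (mv ma : seq nat) (s s' : store) : Prop :=
  (forall x, x \notin mv -> var s' x = var s x) /\
  (forall a k, a \notin ma -> arr s' a k = arr s a k).

Lemma agree_trans mv ma s1 s2 s3 :
  agree mv ma s1 s2 -> agree mv ma s2 s3 -> agree mv ma s1 s3.
Proof.
move=> [v1 a1] [v2 a2]; split=> [x xm|a k am]; first by rewrite v2 // v1.
by rewrite a2 // a1.
Qed.

Lemma run_agree c s : agree (modv c) (moda c) s (run c s).
Proof.
elim: c s => [|x e|a e1 e2|c1 IH1 c2 IH2|b c1 IH1 c2 IH2|x y c IH] s //=.
- by split=> //= z; rewrite inE => /negbTE ->.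
- by split=> //= z k; rewrite inE => /negbTE ->.
- split=> [z|z k]; rewrite mem_cat negb_or => /andP[n1 n2].
    by rewrite (IH2 _).1 // (IH1 _).1.
  by rewrite (IH2 _).2 // (IH1 _).2.
- split=> [z|z k]; rewrite mem_cat negb_or => /andP[n1 n2]; case: ifP => _.
  + by rewrite (IH1 _).1.
  + by rewrite (IH2 _).1.
  + by rewrite (IH1 _).2.
  + by rewrite (IH2 _).2.
elim: `|_|%N => /= [|m [IHv IHa]].
  by split=> //= z; rewrite inE negb_or => /andP[/negbTE ->].
split=> [z|z k zm].
  move=> zm; have := zm; rewrite inE negb_or /= => /andP[/negbTE -> zc].
  by rewrite (IH _).1 // IHv.
by rewrite (IH _).2 //= IHa.
Qed.

Lemma bounds_modv c y : well_formed c -> y \in bounds -> y \notin modv c.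
Proof.
move=> + yb; elim: c => //= [x e|c1 IH1 c2 IH2|b c1 IH1 c2 IH2|x z c IH].
- by rewrite mem_seq1; apply: contra => /eqP <-.
- by case/andP => /IH1 n1 /IH2 n2; rewrite mem_cat negb_or n1.
- by case/andP => /IH1 n1 /IH2 n2; rewrite mem_cat negb_or n1.
case/and4P => xb zb xc /IH yc; rewrite in_cons negb_or yc andbT.
by apply: contra xb => /eqP <-.
Qed.

Lemma exec_run c s N : well_formed c -> (0 < N)%N ->
  (forall y, y \in bounds -> 0 <= var s y <= N%:Z) ->
  exists2 k, exec (compile c) s (run c s) k & (k <= coef c * N ^ depth c)%N.
Proof.
move=> + N0; elim: c s => [|x e|a e1 e2|c1 IH1 c2 IH2|b c1 IH1 c2 IH2|x y c IH] s /=.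
- by move=> _ _; exists 1%N; [exact: ExecSkip|].
- by move=> _ _; exists (expr_cost e).+1; [exact: ExecAssign|rewrite muln1].
- move=> _ _; exists (expr_cost e1 + expr_cost e2).+1; last by rewrite muln1.
  exact: ExecWrite.
- case/andP => w1 w2 sb; have [k1 e1 h1] := IH1 s w1 sb.
  have sb2 y : y \in bounds -> 0 <= var (run c1 s) y <= N%:Z.
    by move=> yb; rewrite (run_agree c1 s).1 ?sb // bounds_modv.
  have [k2 e2 h2] := IH2 _ w2 sb2; exists (k1 + k2)%N; first exact: ExecSeq e1 e2.
  rewrite mulnDl; apply: leq_add; [apply: leq_trans h1 _|apply: leq_trans h2 _];
    by rewrite leq_mul2l (leq_pexp2l N0) ?orbT ?leq_maxl ?leq_maxr.
- case/andP => w1 w2 sb.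
  have le1 : (N ^ depth c1 <= N ^ maxn (depth c1) (depth c2))%N.
    by rewrite leq_pexp2l // leq_maxl.
  have le2 : (N ^ depth c2 <= N ^ maxn (depth c1) (depth c2))%N.
    by rewrite leq_pexp2l // leq_maxr.
  have le0 : (0 < N ^ maxn (depth c1) (depth c2))%N by rewrite expn_gt0 N0.
  case: ifP => bs.
    have [k1 e1 h1] := IH1 s w1 sb; exists (test_cost b + k1).+1; first exact: ExecIfT.
    have : (coef c1 * N ^ depth c1 <= coef c1 * N ^ maxn (depth c1) (depth c2))%N.
      by rewrite leq_mul2l le1 orbT.
    by move: h1 le0; nia.
  have [k2 e2 h2] := IH2 s w2 sb; exists (test_cost b + k2).+1.
    by apply: ExecIfF e2; rewrite bs.
  have : (coef c2 * N ^ depth c2 <= coef c2 * N ^ maxn (depth c1) (depth c2))%N.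
    by rewrite leq_mul2l le2 orbT.
  by move: h2 le0; nia.
case/and4P => xb yb xc wc sb.
pose step s' := set_var (run c s') x (var (run c s') x + 1).
pose K := (coef c * N ^ depth c)%N.
have [m mE mN] : exists2 m : nat, var s y = m%:Z & (m <= N)%N.
  by have := sb _ yb; exists `|var s y|%N; lia.
rewrite mE /= -/step.
have yx : (y == x) = false by apply/negP => /eqP yx; rewrite -yx yb in xb.
(* Here [j] is the number of iterations left. *)
have loop j s' : (forall z, z \in bounds -> var s' z = var s z) ->
    var s' x = m%:Z - j%:Z ->
    exists2 k, exec (While (Not (Le (Var y) (Var x)))
        (Seq (compile c) (Assign x (Add (Var x) (Const 1))))) s' (iter j step s') k
      & (k <= j * (K + 9) + 5)%N.
  elim: j s' => [|j IHj] s' sv sx.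
    exists (test_cost (Not (Le (Var y) (Var x)))).+1 => //.
    by apply: ExecWhileF; rewrite /= sv // mE sx subr0 lexx.
  have sb' z : z \in bounds -> 0 <= var s' z <= N%:Z by move=> zb; rewrite sv ?sb.
  have [k1 e1 h1] := IH s' wc sb'.
  have vx : var (run c s') x = var s' x by rewrite (run_agree c s').1.
  have [|| k2 e2 h2] := IHj (step s').
  - move=> z zb; rewrite /step /= (_ : z == x = false).
      by rewrite (run_agree c s').1 ?sv // bounds_modv.
    by apply/negP => /eqP zx; rewrite -zx zb in xb.
  - by rewrite /step /= eqxx vx sx; lia.
  exists (test_cost (Not (Le (Var y) (Var x))) + (k1 + 4) + k2).+1.
    rewrite iterSr; apply: ExecWhileT e2; first by rewrite /= sv // mE sx; lia.
    by apply: ExecSeq e1 _; exact: ExecAssign.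
  by rewrite /= mulSn; move: h1 h2; rewrite -/K; lia.
have [|| k ek hk] := loop m (set_var s x 0).
- by move=> z zb /=; case: eqP => // zx; rewrite -zx zb in xb.
- by rewrite /= eqxx subrr.
exists (2 + k)%N; first by apply: ExecSeq ek; exact: ExecAssign.
have P0 : (0 < N ^ depth c)%N by rewrite expn_gt0 N0.
apply: (@leq_trans (N * (K + 9) + 7)).
  by have := leq_mul mN (leqnn (K + 9)); lia.
have -> : ((coef c + 16) * N ^ (depth c).+1 = N * (K + 16 * N ^ depth c))%N.
  by rewrite expnS /K; ring.
by rewrite /K; nia.
Qed.

(** * Rules for loops and table updates *)

(** The step may use [agree] with the store before the loop, so facts about untouched variables and
    arrays need not be part of the invariant. *)
Lemma run_for x y c s (m : nat) (P : nat -> store -> Prop) :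
  well_formed (PFor x y c) -> var s y = m%:Z -> P 0%N (set_var s x 0) ->
  (forall i s', (i < m)%N -> var s' x = i%:Z ->
     agree (x :: modv c) (moda c) s s' -> P i s' ->
     P i.+1 (set_var (run c s') x i.+1%:Z)) ->
  P m (run (PFor x y c) s).
Proof.
move=> /= /and4P[xb yb xc wc] ym P0 PS; rewrite ym absz_nat.
pose s_ i := iter i (fun s' => set_var (run c s') x (var (run c s') x + 1))
  (set_var s x 0); rewrite -/(s_ m).
suff [] : [/\ P m (s_ m), var (s_ m) x = m%:Z & agree (x :: modv c) (moda c) s (s_ m)] by [].
elim: {-2}m (leqnn m) => [|i IH] im.
  split=> //=; first by rewrite eqxx.
  by split=> //= z; rewrite inE negb_or => /andP[/negbTE ->].
have [Pi xi ai] := IH (ltnW im).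
have vx : var (run c (s_ i)) x = i%:Z by rewrite (run_agree c _).1 ?xi.
have sE : s_ i.+1 = set_var (run c (s_ i)) x i.+1%:Z.
  by rewrite /s_ /= -/(s_ i) vx -addn1 PoszD.
rewrite sE; split; [exact: PS|by rewrite /= eqxx|].
apply: agree_trans ai _; split=> [z|a k am] /=; last by rewrite (run_agree c _).2.
by rewrite inE negb_or => /andP[/negbTE -> zc]; rewrite (run_agree c _).1.
Qed.

Definition entry (s : store) (q : nat) (k : int) : int * int :=
  (arr s q k, arr s q.+1 k).

Lemma entry_agree mv ma s s' q k : agree mv ma s s' ->
  q \notin ma -> q.+1 \notin ma -> entry s' q k = entry s q k.
Proof. by move=> [_ h] q1 q2; rewrite /entry !h. Qed.

(* Arrays q and q + 1 together hold one table, of pairs (weight, set code). *)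
Definition relax (q : nat) (i x y : expr) : prg :=
  PSeq (PSet 11 x) (PSeq (PSet 12 y) (PSeq (PSet 13 i)
    (PIf (Not (Le (Var 11) (Read q (Var 13))))
      (PSeq (PStore q (Var 13) (Var 11)) (PStore q.+1 (Var 13) (Var 12)))
      PSkip))).

(** The candidate is stored in scratch variables before the index is computed; the hypotheses keep
    [y] and [i] independent of those already overwritten. *)
Lemma run_relax q i x y s :
  (forall u, eval (set_var s 11 u) y = eval s y) ->
  (forall u u', eval (set_var (set_var s 11 u) 12 u') i = eval s i) ->
  forall k, entry (run (relax q i x y) s) q k =
    if (k == eval s i) && (arr s q (eval s i) < eval s x)
    then (eval s x, eval s y) else entry s q k.
Proof.
move=> hy hi k; rewrite /entry /= hy hi -ltNge.
case: (boolP (arr s q (eval s i) < eval s x)) => lt /=; last by rewrite andbF.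
rewrite !eqxx ltn_eqF //= gtn_eqF //= andbT.
by case: eqP.
Qed.

(** * The algorithm *)

Arguments run : simpl never.

Lemma run_seq c1 c2 s : run (PSeq c1 c2) s = run c2 (run c1 s). Proof. by []. Qed.
Lemma run_set x e s : run (PSet x e) s = set_var s x (eval s e). Proof. by []. Qed.
Lemma run_store a e1 e2 s :
  run (PStore a e1 e2) s = set_arr s a (eval s e1) (eval s e2). Proof. by []. Qed.
Lemma run_if b c1 c2 s :
  run (PIf b c1 c2) s = if eval_test s b then run c1 s else run c2 s.
Proof. by []. Qed.
Lemma run_skip s : run PSkip s = s. Proof. by []. Qed.
Definition runE := (run_seq, run_set, run_store, run_if, run_skip).

Definition Lt (e1 e2 : expr) : test := Not (Le e2 e1).

Definition table_at (q x : nat) (e : expr) : expr := Read q (Add (Read 12 (Var x)) e).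
Definition cell_index (x : nat) (e : expr) : expr := Add (Read 12 (Var x)) e.

(* Variables: 0 = n, 1 = p, 2 = n + 1, 8 = the selected job; 3 to 7 and 14 are
   loop counters.  Arrays: 0-2 input, 3 output, 4 = sorted release times R with
   a sentinel at n, 5-6 marks, 7-8 = V, 9-10 = T, 11 = c and 18 = R b - u for
   phase 1, 12 = row offsets, 13 = powers of 2, 14-15 = A, 16-17 = W. *)

(** The value [n] in variable 8 means that no job has been chosen yet. *)
Definition select_min (q z : nat) : prg :=
  PSeq (PSet 8 (Var 0))
    (PFor 14 0 (PIf (Eq (Read z (Var 14)) (Const 0))
      (PIf (Eq (Var 8) (Var 0)) (PSet 8 (Var 14))
        (PIf (Lt (Read q (Var 14)) (Read q (Var 8))) (PSet 8 (Var 14)) PSkip))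
      PSkip)).

(** Doubling and repeated addition stand in for multiplication: powers of 2 encode sets, multiples
    of [n + 1] address the rows of two-dimensional tables. *)
Definition make_tables : prg :=
  PSeq (PStore 13 (Const 0) (Const 1))
    (PFor 3 0 (PSeq
      (PStore 13 (Add (Var 3) (Const 1)) (Add (Read 13 (Var 3)) (Read 13 (Var 3))))
      (PStore 12 (Add (Var 3) (Const 1)) (Add (Read 12 (Var 3)) (Var 2))))).

Definition sort_releases : prg :=
  PFor 3 0 (PSeq (select_min 0 5)
    (PSeq (PStore 4 (Var 3) (Read 0 (Var 8))) (PStore 5 (Var 8) (Const 1)))).

Definition set_sentinel : prg :=
  PSeq (PSet 10 (Read 4 (Defs.Sub (Var 0) (Const 1))))
    (PSeq (PFor 3 0 (PIf (Lt (Var 10) (Read 1 (Var 3))) (PSet 10 (Read 1 (Var 3))) PSkip))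
      (PStore 4 (Var 0) (Var 10))).

(** Division by repeated addition, capped at [n] steps. A linear cost for each job and each pair of
    start indices stays within the bound. *)
Definition count_steps : prg :=
  PSeq (PSet 9 (Const 0)) (PSeq (PSet 10 (Read 4 (Var 4)))
    (PFor 7 0 (PIf (Le (Add (Var 10) (Var 1)) (Read 4 (Var 5)))
      (PSeq (PSet 10 (Add (Var 10) (Var 1))) (PSet 9 (Add (Var 9) (Const 1))))
      PSkip))).

(** Array 18 holds the idle time [R b - (R a + p m)]. That it does not decrease from [b'] to [b] is
    equivalent to [R b' + p (m - m') <= R b], with no product to compute. *)
Definition chain_relax : prg :=
  PIf (And (Lt (Var 6) (Var 5)) (And (Le (Read 11 (Var 6)) (Var 9))
         (Le (Read 18 (Var 6)) (Read 18 (Var 5)))))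
    (relax 9 (Var 5)
       (Add (Read 9 (Var 6)) (table_at 7 6 (Defs.Sub (Var 9) (Read 11 (Var 6)))))
       (Add (Read 10 (Var 6)) (table_at 8 6 (Defs.Sub (Var 9) (Read 11 (Var 6))))))
    PSkip.

(** The mark [n + 1] in array 11 exceeds every job count, so later comparisons discard the indices
    [b] at which no chain may end. *)
Definition chain_row : prg :=
  PFor 5 0 (PSeq count_steps
    (PIf (And (Le (Var 10) (Read 4 (Var 5)))
           (And (Lt (Read 4 (Var 5)) (Add (Var 10) (Var 1)))
                (Le (Read 0 (Var 8)) (Var 10))))
      (PSeq (PStore 11 (Var 5) (Var 9))
        (PSeq (PStore 18 (Var 5) (Defs.Sub (Read 4 (Var 5)) (Var 10)))
          (PSeq (PStore 9 (Var 5) (table_at 7 4 (Var 9)))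
            (PSeq (PStore 10 (Var 5) (table_at 8 4 (Var 9)))
              (PFor 6 0 chain_relax)))))
      (PStore 11 (Var 5) (Var 2)))).

Definition next_cell : expr := cell_index 4 (Add (Var 7) (Const 1)).

Definition insert_relax : prg :=
  PIf (Le (Read 11 (Var 5)) (Var 7))
    (relax 14 next_cell
       (Add (Read 2 (Var 8))
         (Add (Read 9 (Var 5)) (table_at 7 5 (Defs.Sub (Var 7) (Read 11 (Var 5))))))
       (Add (Read 13 (Var 8))
         (Add (Read 10 (Var 5)) (table_at 8 5 (Defs.Sub (Var 7) (Read 11 (Var 5)))))))
    PSkip.

(** Variable 10 runs through the values [R a + p i]. Entries of [A] are cleared because they stem
    from the previously inserted job. *)
Definition insert_row : prg :=
  PSeq (PSet 10 (Read 4 (Var 4)))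
    (PFor 7 0 (PSeq (PStore 14 next_cell (Const 0)) (PSeq (PStore 15 next_cell (Const 0))
      (PSeq (PIf (And (Le (Read 4 (Var 4)) (Read 0 (Var 8)))
                      (Le (Add (Var 10) (Var 1)) (Read 1 (Var 8))))
               (PSeq (PIf (Le (Read 0 (Var 8)) (Var 10))
                       (relax 14 next_cell
                         (Add (Read 2 (Var 8)) (table_at 7 4 (Var 7)))
                         (Add (Read 13 (Var 8)) (table_at 8 4 (Var 7))))
                       PSkip)
                 (PFor 5 0 insert_relax))
               PSkip)
        (PSet 10 (Add (Var 10) (Var 1))))))).

Definition phase1 : prg := PFor 4 0 (PSeq chain_row insert_row).

Definition copy_row : prg :=
  PFor 7 0 (relax 7 next_cell (Read 14 next_cell) (Read 15 next_cell)).

Definition join_relax : prg :=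
  PIf (Le (Add (Var 9) (Var 7)) (Var 0))
    (relax 7 (cell_index 4 (Add (Var 9) (Var 7)))
       (Add (table_at 7 4 (Var 9)) (table_at 7 5 (Var 7)))
       (Add (table_at 8 4 (Var 9)) (table_at 8 5 (Var 7))))
    PSkip.

Definition join_row : prg :=
  PFor 5 0 (PSeq count_steps
    (PIf (Eq (Var 10) (Read 4 (Var 5))) (PFor 7 2 join_relax) PSkip)).

(** The counter ascends but the rows descend: a row is joined with rows of later starts, which must
    be finished. *)
Definition phase2 : prg :=
  PFor 14 0 (PSeq (PSet 4 (Defs.Sub (Defs.Sub (Var 0) (Const 1)) (Var 14)))
    (PSeq copy_row join_row)).

Definition process_jobs : prg :=
  PFor 3 0 (PSeq (select_min 1 6)
    (PSeq (PStore 6 (Var 8) (Const 1)) (PSeq phase1 phase2))).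

Definition final_relax : prg :=
  PIf (And (Lt (Var 6) (Var 5)) (Le (Var 10) (Read 4 (Var 5))))
    (relax 16 (Var 5) (Add (Read 16 (Var 6)) (table_at 7 6 (Var 7)))
       (Add (Read 17 (Var 6)) (table_at 8 6 (Var 7))))
    PSkip.

Definition final_chain : prg :=
  PFor 5 2 (PSeq (PStore 16 (Var 5) (Const 0)) (PSeq (PStore 17 (Var 5) (Const 0))
    (PFor 6 0 (PSeq (PSet 10 (Read 4 (Var 6)))
      (PFor 7 2 (PSeq final_relax (PSet 10 (Add (Var 10) (Var 1))))))))).

(** Binary expansion from the highest power down. *)
Definition decode : prg :=
  PSeq (PSet 15 (Read 17 (Var 0)))
    (PFor 5 0 (PSeq (PSet 4 (Defs.Sub (Defs.Sub (Var 0) (Const 1)) (Var 5)))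
      (PIf (Le (Read 13 (Var 4)) (Var 15))
        (PSeq (PSet 15 (Defs.Sub (Var 15) (Read 13 (Var 4)))) (PStore 3 (Var 4) (Const 1)))
        PSkip))).

Definition main_prg : prg :=
  PSeq make_tables (PSeq sort_releases (PSeq set_sentinel
    (PSeq process_jobs (PSeq final_chain decode)))).

Lemma main_prg_wf : well_formed main_prg.
Proof. by vm_compute. Qed.

(** The deepest nests range over the job, two start indices, and one further loop over starts, job
    counts or multiples of [p]. *)
Lemma main_prg_depth : depth main_prg = 4.
Proof. by vm_compute. Qed.

(** The two inequalities serve completeness; the last clause serves soundness, since the new entry
    is the old one or the candidate. *)
Lemma relaxP q i x y s i0 x0 y0 :
  (forall u, eval (set_var s 11 u) y = eval s y) ->
  (forall u u', eval (set_var (set_var s 11 u) 12 u') i = eval s i) ->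
  eval s i = i0 -> eval s x = x0 -> eval s y = y0 ->
  let s' := run (relax q i x y) s in
  [/\ forall k, k != i0 -> entry s' q k = entry s q k,
      (entry s q i0).1 <= (entry s' q i0).1, x0 <= (entry s' q i0).1
    & forall P : int * int -> Prop, P (entry s q i0) -> P (x0, y0) -> P (entry s' q i0)].
Proof.
move=> hy hi ei ex ey s'; have sE := run_relax q x hy hi; rewrite -/s' ei ex ey in sE.
rewrite sE eqxx /=; split=> [k ki|||P P1 P2].
- by rewrite sE (negbTE ki).
- by case: ifP => //= /ltW.
- by case: ifP => //= /negbT; rewrite -leNgt.
- by case: ifP.
Qed.

Definition cell n (s : store) (q a i : nat) : int * int :=
  entry s q (a * n.+1 + i)%N%:Z.

Lemma cell_index_inj n (a a' i i' : nat) : (i <= n)%N -> (i' <= n)%N ->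
  (a * n.+1 + i)%N%:Z = (a' * n.+1 + i')%N%:Z -> a = a' /\ i = i'.
Proof.
move=> hi hi' [] e; have ea : a = a'.
  by have := congr1 (divn^~ n.+1) e; rewrite /= !divnMDl // !divn_small ?addn0.
by move: e; rewrite ea => /addnI.
Qed.

(** * Correctness of the algorithm *)

Section Correctness.

Variables (n : nat) (I : jobs n).
Hypothesis len_gt0 : 1 <= len I.

Implicit Types (J K : {set 'I_n}) (s : store).

Notation p := (len I).
Notation r := (release I).
Notation d := (deadline I).
Notation weights := (total (weight I)).
Notation codes := (total (fun j : 'I_n => 2 ^+ j)).

Lemma selectP q z s (key : 'I_n -> int) K : var s 0 = n%:Z ->
  (forall j : 'I_n, arr s q j%:Z = key j) ->
  (forall j : 'I_n, (arr s z j%:Z == 0) = (j \notin K)) -> K != setT ->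
  exists k : 'I_n, [/\ var (run (select_min q z) s) 8 = k%:Z, k \notin K
    & forall j, j \notin K -> key k <= key j].
Proof.
move=> s0 hq hz KT; rewrite /select_min runE.
pose P (i : nat) s' :=
  (var s' 8 = n%:Z /\ forall j : 'I_n, (j < i)%N -> j \in K) \/
  exists k : 'I_n, [/\ var s' 8 = k%:Z, k \notin K
    & forall j : 'I_n, (j < i)%N -> j \notin K -> key k <= key j].
have : P n (run (PFor 14 0 (PIf (Eq (Read z (Var 14)) (Const 0))
      (PIf (Eq (Var 8) (Var 0)) (PSet 8 (Var 14))
        (PIf (Lt (Read q (Var 14)) (Read q (Var 8))) (PSet 8 (Var 14)) PSkip))
      PSkip)) (run (PSet 8 (Var 0)) s)); last first.
  case=> [[_ hK]|[k [e kK kmin]]]; last by exists k; split=> // j; apply: kmin.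
  by case/negP: KT; apply/eqP/setP => j; rewrite hK ?inE.
apply: run_for => //; first by left; rewrite runE /= s0.
move=> i s' il si ag Ps'.
have s'0 : var s' 0 = n%:Z by rewrite ag.1.
have hq' (j : 'I_n) : arr s' q j%:Z = key j by rewrite ag.2 // hq.
have hz' (j : 'I_n) : (arr s' z j%:Z == 0) = (j \notin K) by rewrite ag.2 // hz.
pose ji := Ordinal il.
have hS (Q : 'I_n -> Prop) : (forall j : 'I_n, (j < i)%N -> Q j) -> Q ji ->
    forall j : 'I_n, (j < i.+1)%N -> Q j.
  move=> h1 h2 j; rewrite ltnS leq_eqVlt => /orP[/eqP ji'|/h1//].
  by rewrite (_ : j = ji) //; apply: val_inj.
rewrite !runE /= si (hz' ji); case: (boolP (ji \in K)) => jiK /=.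
  case: Ps' => [[e hK]|[k [e kK kmin]]]; [left|right].
    by split=> //; apply: hS.
  by exists k; split=> //; apply: hS => //; rewrite jiK.
case: Ps' => [[e hK]|[k [e kK kmin]]].
  rewrite e s'0 eqxx; right; exists ji; split=> //.
  by apply: hS => // j /hK ->.
rewrite e s'0 eqz_nat (_ : (nat_of_ord k == n) = false); last first.
  by apply/negbTE; rewrite neq_ltn ltn_ord.
rewrite (hq' k) (hq' ji) -ltNge; case: ltrP => lt; right.
  exists ji; split=> //.
  by apply: hS => // j ji' jK; apply: ltW; apply: lt_le_trans lt (kmin j ji' jK).
by exists k; split=> //; apply: hS => // _; exact: lt.
Qed.

Variable R : nat -> int.
Hypothesis R_mono : forall a b, (a <= b <= n)%N -> R a <= R b.
Hypothesis R_release : forall j, exists2 b, (b < n)%N & R b = r j.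
Hypothesis R_last : forall j, d j <= R n.

(** * Invariants of the store *)

Record base s : Prop := Base {
  base_n : var s 0 = n%:Z;
  base_p : var s 1 = p;
  base_n1 : var s 2 = n.+1%:Z;
  base_r : forall j : 'I_n, arr s 0 j%:Z = r j;
  base_d : forall j : 'I_n, arr s 1 j%:Z = d j;
  base_w : forall j : 'I_n, arr s 2 j%:Z = weight I j;
  base_R : forall b, (b <= n)%N -> arr s 4 b%:Z = R b;
  base_row : forall a, (a <= n)%N -> arr s 12 a%:Z = (a * n.+1)%N%:Z;
  base_pow : forall j, (j <= n)%N -> arr s 13 j%:Z = 2 ^+ j
}.

Lemma base_agree mv ma s s' : agree mv ma s s' ->
  ~~ has (mem mv) [:: 0; 1; 2]%N -> ~~ has (mem ma) [:: 0; 1; 2; 4; 12; 13]%N ->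
  base s -> base s'.
Proof.
move=> [av aa]; rewrite /= !negb_or => /and4P[m0 m1 m2 _].
case/and5P => a0 a1 a2 a4 /and3P[a12 a13 _] [*]; split=> *;
  by rewrite ?av ?aa //; auto.
Qed.

Lemma base_set_var s x u : x \notin [:: 0; 1; 2]%N -> base s -> base (set_var s x u).
Proof.
move=> xn; apply: (@base_agree [:: x] [::]) => //.
  by split=> //= z; rewrite inE => /negbTE ->.
by rewrite /= !mem_seq1 -![_ == x]eq_sym; move: xn; rewrite !inE !negb_or andbT.
Qed.

Lemma base_set_arr s a i u : a \notin [:: 0; 1; 2; 4; 12; 13]%N -> base s ->
  base (set_arr s a i u).
Proof.
move=> an; apply: (@base_agree [::] [:: a]) => //.
  by split=> //= z j; rewrite inE => /negbTE ->.
by rewrite /= !mem_seq1 -![_ == a]eq_sym; move: an; rewrite !inE !negb_or andbT.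
Qed.

Lemma evalD s e1 e2 : eval s (Add e1 e2) = eval s e1 + eval s e2.
Proof. by []. Qed.

(** Weight and code come from one and the same set, so decoding recovers a set of the stated
    weight. *)
Definition represents (P : {set 'I_n} -> Prop) (e : int * int) : Prop :=
  exists2 J, P J & e = (weights J, codes J).

Lemma represents_empty (P : {set 'I_n} -> Prop) : P set0 -> represents P (0, 0).
Proof. by exists set0 => //; rewrite !total0. Qed.

Lemma represents_sub (P Q : {set 'I_n} -> Prop) e : (forall J, P J -> Q J) ->
  represents P e -> represents Q e.
Proof. by move=> PQ [J /PQ]; exists J. Qed.

Lemma representsU (P P1 P2 : {set 'I_n} -> Prop) e1 e2 :
  (forall J1 J2, P1 J1 -> P2 J2 -> [disjoint J1 & J2] /\ P (J1 :|: J2)) ->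
  represents P1 e1 -> represents P2 e2 ->
  represents P (e1.1 + e2.1, e1.2 + e2.2).
Proof.
move=> PU [J1 h1 ->] [J2 h2 ->]; have [dis PJ] := PU _ _ h1 h2.
by exists (J1 :|: J2) => //=; rewrite !totalU.
Qed.

Lemma representsU1 (P P1 : {set 'I_n} -> Prop) e (k : 'I_n) :
  (forall J, P1 J -> k \notin J /\ P (k |: J)) ->
  represents P1 e -> represents P (weight I k + e.1, 2 ^+ k + e.2).
Proof.
move=> PU [J h ->]; have [kJ PJ] := PU _ h.
by exists (k |: J) => //=; rewrite !total_setU1.
Qed.

Notation block_set := (block_set I R).
Notation chain_set := (chain_set I R).
Notation tick := (tick I R).

Definition sound K (V : nat -> nat -> int * int) : Prop :=
  forall a i, (a < n)%N -> (i <= n)%N -> represents (block_set K a i) (V a i).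

Lemma tick_uniq k a b m m' : tick k a b m -> tick k a b m' -> m = m'.
Proof.
have lt (m1 m2 : nat) : tick k a b m1 -> tick k a b m2 -> (m1 <= m2)%N.
  move=> /and3P[h1 _ _] /and3P[_ h2 _]; rewrite leqNgt; apply/negP => m12.
  by have := len_leM len_gt0 m12; have := lenS I m2; lia.
by move=> h1 h2; apply/eqP; rewrite eqn_leq !lt.
Qed.

(** The disjunctions allow for [R b < R a], where the count stays 0, and for the cap at [n]. *)
Lemma count_stepsP s (a b : nat) : base s -> (a <= n)%N -> (b <= n)%N ->
  var s 4 = a%:Z -> var s 5 = b%:Z ->
  exists m : nat, [/\ (m <= n)%N, var (run count_steps s) 9 = m%:Z,
    var (run count_steps s) 10 = R a + p * m%:Z,
    m = 0%N \/ R a + p * m%:Z <= R b & m = n \/ R b < R a + p * m%:Z + p].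
Proof.
move=> Bs an bn s4 s5; rewrite /count_steps !runE.
set s1 := set_var _ 10 _; set body := PFor _ _ _.
pose P (i : nat) s' := exists m : nat, [/\ (m <= i)%N, var s' 9 = m%:Z,
  var s' 10 = R a + p * m%:Z,
  m = 0%N \/ R a + p * m%:Z <= R b & m = i \/ R b < R a + p * m%:Z + p].
suff : P n (run body s1) by [].
apply: run_for => //; first exact: base_n Bs.
  exists 0%N; split=> //=; [|by left|by left].
  by rewrite s4 (base_R Bs an) mulr0 addr0.
move=> i s' il si ag [m [mi e9 e10 h1 h2]].
have Bs' : base s' by apply: base_agree ag _ _ _ => //; do 2!apply: base_set_var => //.
have e5 : var s' 5 = b%:Z by rewrite ag.1.
rewrite !runE /= e10 (base_p Bs') e5 (base_R Bs' bn).
case: lerP => h; last first.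
  by exists m; split=> //=; [exact: leqW|right].
exists m.+1; rewrite /= e9 lenS addrA; split=> //.
- by rewrite -addn1 PoszD.
- by right.
case: h2 => [->|h2]; first by left.
by have : False by lia.
Qed.

(** * Chains of blocks and the insertion of a job *)

Section Phases.

Variables (K : {set 'I_n}) (k : 'I_n) (V : nat -> nat -> int * int).
Hypothesis k_new : k \notin K.
Hypothesis k_last : forall j, j \in K -> d j <= d k.
Hypothesis V_sound : sound K V.

Notation v := (fun a i => (V a i).1).

Lemma table_at_eval s q x a i (m : nat) : base s -> (a <= n)%N -> var s x = a%:Z ->
  eval s i = m%:Z ->
  eval s (table_at q x i) = arr s q (a * n.+1 + m)%N%:Z.
Proof. by move=> Bs an sx si; rewrite /= sx si (base_row Bs an). Qed.

Lemma cell_index_eval s x a i (m : nat) : base s -> (a <= n)%N -> var s x = a%:Z ->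
  eval s i = m%:Z -> eval s (cell_index x i) = (a * n.+1 + m)%N%:Z.
Proof. by move=> Bs an sx si; rewrite /= sx si (base_row Bs an). Qed.

(** In the first case the other arrays may hold stale values at [b]; the mark [n + 1] keeps them
    from being used. *)
Definition chain_cell a s (b : nat) : Prop :=
  (arr s 11 b%:Z = n.+1%:Z /\ forall m, (m <= n)%N -> ~~ tick k a b m) \/
  exists m : nat,
    [/\ (m <= n)%N, tick k a b m, arr s 11 b%:Z = m%:Z,
        arr s 18 b%:Z = R b - (R a + p * m%:Z) &
    [/\ represents (chain_set K k a b m) (entry s 9 b%:Z),
        v a m <= (entry s 9 b%:Z).1 &
        forall b' m', (b' < b)%N -> (m' <= m)%N -> tick k a b' m' ->
          R b' + p * (m - m')%N%:Z <= R b ->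
          (entry s 9 b'%:Z).1 + v b' (m - m')%N <= (entry s 9 b%:Z).1]].

Lemma chain_rowP s (a : nat) : base s -> (forall a i, cell n s 7 a i = V a i) ->
  (a < n)%N -> var s 4 = a%:Z -> var s 8 = k%:Z ->
  forall b, (b < n)%N -> chain_cell a (run chain_row s) b.
Proof.
move=> Bs hV an s4 s8.
pose P (i : nat) s' := forall b, (b < i)%N -> chain_cell a s' b.
suff : P n (run chain_row s) by [].
apply: run_for => //; first exact: base_n Bs.
move=> b s' bn sb ag Ps'.
have Bs' : base s' by apply: base_agree ag _ _ Bs.
have hV' a' i : cell n s' 7 a' i = V a' i.
  by rewrite -hV; apply: entry_agree ag _ _.
have s'4 : var s' 4 = a%:Z by rewrite ag.1.
have s'8 : var s' 8 = k%:Z by rewrite ag.1.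
have [m [mn e9 e10 h1 h2]] := count_stepsP Bs' (ltnW an) (ltnW bn) s'4 sb.
have ag1 := run_agree count_steps s'.
rewrite run_seq; set s1 := run count_steps s' in e9 e10 ag1 *.
have Bs1 : base s1 by apply: base_agree ag1 _ _ Bs'.
have s14 : var s1 4 = a%:Z by rewrite ag1.1.
have s15 : var s1 5 = b%:Z by rewrite ag1.1.
have s18 : var s1 8 = k%:Z by rewrite ag1.1.
have Ps1 : P b s1.
  move=> b' b'b; have := Ps' b' b'b; rewrite /chain_cell.
  rewrite !(ag1.2 11) // !(ag1.2 18) //.
  case=> [?|[m' [? ? ? ? [? ? h]]]]; [by left|right; exists m'].
  by split=> //; rewrite !(entry_agree (q := 9) _ ag1) //; split=> // b2 m2 *;
    rewrite (entry_agree _ ag1) //; apply: h.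
have V1 a' i : cell n s1 7 a' i = V a' i.
  by rewrite -hV'; apply: entry_agree ag1 _ _.
have [an' bn'] := (ltnW an, ltnW bn).
rewrite run_if /= e10 s15 s18 (base_R Bs1 bn') (base_p Bs1) (base_r Bs1 k) -ltNge.
have tickE : (R a + p * m%:Z <= R b) && ((R b < R a + p * m%:Z + p)
   && (r k <= R a + p * m%:Z)) = tick k a b m by [].
rewrite tickE; case: (boolP (tick k a b m)) => tk; last first.
  rewrite runE => b'; rewrite ltnS leq_eqVlt => /orP[/eqP ->|b'b].
    left; rewrite /= s15 eqxx /= (base_n1 Bs1); split=> // m' m'n; apply/negP => tk'.
    case/negP: tk; case/and3P: (tk') => t1 t2 t3.
    (* A tick of at most [n] must equal the count, since the cap matters only for larger
       quotients. *)
    suff -> : m = m' by [].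
    apply/eqP; rewrite eqn_leq; apply/andP; split; rewrite leqNgt; apply/negP => lt.
      case: h1 => [m0|h1]; first by rewrite m0 in lt.
      by have := len_leM len_gt0 lt; rewrite lenS; lia.
    case: h2 => [mE|h2]; first by rewrite mE ltnNge m'n in lt.
    by have := len_leM len_gt0 lt; rewrite lenS; lia.
  have b'E : (b'%:Z == b%:Z) = false by rewrite eqz_nat ltn_eqF.
  have := Ps1 b' b'b; rewrite /chain_cell /= s15 b'E /=.
  case=> [?|[m' [? ? ? ? [? ? h]]]]; [by left|right; exists m'].
  by split=> //; split=> // b2 m2 lt2 *; apply: h.
rewrite !runE; set s2 := set_arr s1 11 _ _; set s3 := set_arr s2 18 _ _.
set s4' := set_arr s3 9 _ _; set s5 := set_arr s4' 10 _ _.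
have e5 : entry s5 9 b%:Z = V a m.
  rewrite -V1 /cell /entry /s5 /s4' /s3 /s2 /= s15 s14 e9 (base_row Bs1 an') /=.
  by rewrite eqxx.
have e5' b' : (b' < b)%N -> [/\ entry s5 9 b'%:Z = entry s1 9 b'%:Z,
    arr s5 11 b'%:Z = arr s1 11 b'%:Z & arr s5 18 b'%:Z = arr s1 18 b'%:Z].
  move=> b'b; have b'E : (b'%:Z == b%:Z) = false by rewrite eqz_nat ltn_eqF.
  by rewrite /entry /s5 /s4' /s3 /s2 /= s15 b'E.
have c5 : arr s5 11 b%:Z = m%:Z by rewrite /= s15 eqxx /= e9.
have f5 : arr s5 18 b%:Z = R b - (R a + p * m%:Z).
  by rewrite /= s15 eqxx /= e10 (base_R Bs1 bn').
have v5 x : var s5 x = var s1 x by [].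
have Bs5 : base s5.
  apply: (@base_agree [::] [:: 11; 18; 9; 10]%N s1) => //; split=> // q z.
  by rewrite !inE !negb_or => /and4P[/negbTE q1 /negbTE q2 /negbTE q3 /negbTE q4];
    rewrite /= q1 q2 q3 q4.
have V5 a' i : cell n s5 7 a' i = V a' i by rewrite -V1.
pose Q (i : nat) s6 := [/\ forall b', (b' < b)%N -> entry s6 9 b'%:Z = entry s5 9 b'%:Z,
  represents (chain_set K k a b m) (entry s6 9 b%:Z), v a m <= (entry s6 9 b%:Z).1 &
  forall b' m', (b' < i)%N -> (b' < b)%N -> (m' <= m)%N -> tick k a b' m' ->
    R b' + p * (m - m')%N%:Z <= R b ->
    (entry s5 9 b'%:Z).1 + v b' (m - m')%N <= (entry s6 9 b%:Z).1].
have ag6 := run_agree (PFor 6 0 chain_relax) s5.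
have : Q n (run (PFor 6 0 chain_relax) s5).
  apply: run_for => //; first exact: base_n Bs5.
    have e50 : entry (set_var s5 6 0) 9 b%:Z = V a m := e5.
    split=> //; rewrite e50 //.
    apply: represents_sub (V_sound an mn) => J; exact: chain_set_base.
  move=> b' s6 b'n s66 ag5 [q1 q2 q3 q4].
  have Bs6 : base s6 by apply: base_agree ag5 _ _ Bs5.
  have V6 a' i : cell n s6 7 a' i = V a' i.
    by rewrite -V5; apply: entry_agree ag5 _ _.
  have [s65 s69] : var s6 5 = b%:Z /\ var s6 9 = m%:Z by rewrite !ag5.1 // !v5.
  have c6 : arr s6 11 b%:Z = m%:Z by rewrite ag5.2.
  have f6 : arr s6 18 b%:Z = R b - (R a + p * m%:Z) by rewrite ag5.2.
  rewrite /chain_relax run_if /= s66 s65 s69 lez_nat -ltnNge.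
  (* If [b'] admits no extension, nothing is written and the new clause of the invariant is
     vacuous. *)
  have skip : (forall m', (b' < b)%N -> (m' <= m)%N -> tick k a b' m' ->
      R b' + p * (m - m')%N%:Z <= R b -> False) -> Q b'.+1 (set_var s6 6 b'.+1%:Z).
    move=> sk; split=> // b2 m2; rewrite ltnS leq_eqVlt => /orP[/eqP ->|b2b].
      by move=> *; exfalso; apply: (sk m2).
    exact: q4.
  case: (ltnP b' b) => b'b /=; last by rewrite runE; apply: skip; move=> *; lia.
  have [_ c6' f6'] := e5' b' b'b.
  have c6E : arr s6 11 b'%:Z = arr s1 11 b'%:Z by rewrite ag5.2.
  have f6E : arr s6 18 b'%:Z = arr s1 18 b'%:Z by rewrite ag5.2.
  rewrite f6.
  case: (Ps1 b' b'b) => [[c1 nt]|[m1 [m1n tk1 c1 f1 [T1 T2 T3]]]].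
    rewrite c6E c1 lez_nat ltnNge mn /= runE; apply: skip => m' _ m'm tk'.
    by have := nt m' (leq_trans m'm mn); rewrite tk'.
  rewrite c6E c1 f6E f1 lez_nat.
  have pE : (m1 <= m)%N -> p * (m - m1)%N%:Z = p * m%:Z - p * m1%:Z.
    by move=> m1m; rewrite -mulrBr subzn.
  case: (boolP (m1 <= m)%N) => m1m; last first.
    by rewrite /= runE; apply: skip => m' _ m'm /(tick_uniq tk1) E; rewrite E m'm in m1m.
  case: lerP => fr /=; last first.
    by rewrite runE; apply: skip => m' _ m'm /(tick_uniq tk1) <-; rewrite pE //; lia.
  have cE : eval s6 (Defs.Sub (Var 9) (Read 11 (Var 6))) = (m - m1)%N%:Z.
    by rewrite /= s69 s66 c6E c1 subzn.
  have e69 : entry s6 9 b'%:Z = entry s1 9 b'%:Z.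
    by rewrite q1 //; have [] := e5' b' b'b.
  have [|||||r1 r2 r3 r4] := @relaxP 9 (Var 5)
    (Add (Read 9 (Var 6)) (table_at 7 6 (Defs.Sub (Var 9) (Read 11 (Var 6)))))
    (Add (Read 10 (Var 6)) (table_at 8 6 (Defs.Sub (Var 9) (Read 11 (Var 6)))))
    s6 b%:Z ((entry s1 9 b'%:Z).1 + (V b' (m - m1)%N).1)
    ((entry s1 9 b'%:Z).2 + (V b' (m - m1)%N).2) => //.
  - rewrite evalD (table_at_eval _ Bs6 (ltnW b'n) s66 cE) -V6 -e69.
    by rewrite /= s66.
  - rewrite evalD (table_at_eval _ Bs6 (ltnW b'n) s66 cE) -V6 -e69.
    by rewrite /= s66.
  set s7 := run _ s6 in r1 r2 r3 r4.
  split.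
  - by move=> b2 b2b; rewrite -q1 //; apply: r1; rewrite eqz_nat ltn_eqF.
  - apply: r4 => //; rewrite -/(_.1, _.2).
    apply: (representsU (P1 := chain_set K k a b' m1) (P2 := block_set K b' (m - m1))) => //.
    + by move=> J1 J2; apply: chain_set_step => //; rewrite pE //; lia.
    + by apply: V_sound => //; lia.
  - exact: le_trans r2.
  move=> b2 m2; rewrite ltnS leq_eqVlt => /orP[/eqP ->|b2b'].
    move=> _ m2m tk2 _; rewrite -(tick_uniq tk1 tk2).
    by have [-> _ _] := e5' b' b'b; exact: r3.
  by move=> h1' h2' h3' h4'; apply: le_trans r2; apply: q4.
have ag6' := run_agree (PFor 6 0 chain_relax) s5.
set s6 := run _ s5 in ag6' *; case=> [q1 q2 q3 q4].
suff : forall b', (b' < b.+1)%N -> chain_cell a s6 b' by [].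
move=> b'; rewrite ltnS leq_eqVlt => /orP[/eqP ->|b'b].
  right; exists m; split=> //; [by rewrite ag6'.2|by rewrite ag6'.2|].
  split=> // b2 m2 b2b *; rewrite q1 //.
  by apply: q4 => //; apply: ltn_trans b2b bn.
have [e1 e2 e3] := e5' b' b'b.
have := Ps1 b' b'b; rewrite /chain_cell !(ag6'.2 11) // !(ag6'.2 18) // e2 e3.
case=> [?|[m' [? ? ? ? [? ? h]]]]; [by left|right; exists m'].
rewrite q1 // e1; split=> //; split=> // b2 m2 lt2 *.
have lt3 := ltn_trans lt2 b'b; rewrite q1 //.
by have [-> _ _] := e5' b2 lt3; apply: h.
Qed.

Lemma chain_cell_table a s : (a < n)%N ->
  (forall b, (b < n)%N -> chain_cell a s b) ->
  chain_table I R k a v (fun b => (entry s 9 b%:Z).1).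
Proof.
move=> an cc b m bn mn tk; case: (cc b bn) => [[_ nt]|]; first by have := nt m mn; rewrite tk.
by move=> [m' [m'n tk' _ _ [_ h1 h2]]]; rewrite (tick_uniq tk tk'); split.
Qed.

Definition insert_cell a s (i : nat) : Prop :=
  represents (block_set (k |: K) a i.+1) (cell n s 14 a i.+1) /\
  (R a <= r k -> R a + p * i%:Z + p <= d k ->
   (r k <= R a + p * i%:Z -> weight I k + v a i <= (cell n s 14 a i.+1).1) /\
   exists2 T, chain_table I R k a v T &
     forall b m, (b < n)%N -> (m <= i)%N -> tick k a b m ->
       weight I k + (T b + v b (i - m)%N) <= (cell n s 14 a i.+1).1).

Lemma insert_rowP s (a : nat) : base s -> (forall a i, cell n s 7 a i = V a i) ->
  (a < n)%N -> var s 4 = a%:Z -> var s 8 = k%:Z ->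
  (forall b, (b < n)%N -> chain_cell a s b) ->
  let s' := run insert_row s in
  (forall i, (i < n)%N -> insert_cell a s' i) /\
  (forall a' i, a' != a -> (i <= n)%N -> cell n s' 14 a' i = cell n s 14 a' i).
Proof.
move=> Bs hV an s4 s8 cc /=; have an' := ltnW an.
have Tc := chain_cell_table an cc.
rewrite /insert_row run_seq run_set; set s1 := set_var s 10 _.
have Bs1 : base s1 by apply: base_set_var.
set body := PFor 7 0 _.
pose P (i : nat) s' := [/\ var s' 10 = R a + p * i%:Z,
  (forall j, (j < i)%N -> insert_cell a s' j) &
  (forall a' j, a' != a -> (j <= n)%N -> cell n s' 14 a' j = cell n s 14 a' j)].
suff : P n (run body s1) by case.
apply: run_for => //; first exact: base_n Bs1.
  by split=> //=; rewrite s4 (base_R Bs an') mulr0 addr0.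
move=> i s' il si ag [e10 PI PO].
have Bs' : base s' by apply: base_agree ag _ _ Bs1.
have s'4 : var s' 4 = a%:Z by rewrite ag.1.
have s'8 : var s' 8 = k%:Z by rewrite ag.1.
set i0 := (a * n.+1 + i.+1)%N%:Z.
have idxE s2 : base s2 -> var s2 4 = a%:Z -> var s2 7 = i%:Z -> eval s2 next_cell = i0.
  move=> B2 s24 s27; rewrite /next_cell (cell_index_eval B2 an' s24 (m := i.+1)) //.
  by rewrite /= s27 -addn1.
have ne a' j : (j <= n)%N -> (a' != a) || (j != i.+1) -> (a' * n.+1 + j)%N%:Z != i0.
  by move=> jn; apply: contraL => /eqP /(cell_index_inj jn il) [-> ->]; rewrite !eqxx.
rewrite !run_seq [run (PStore 14 _ _) _]run_store (idxE s') //.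
set s2 := set_arr s' 14 _ _.
have Bs2 : base s2 by apply: base_set_arr.
rewrite [run (PStore 15 _ _) _]run_store (idxE s2) //.
set s3 := set_arr s2 15 _ _.
have Bs3 : base s3 by apply: base_set_arr.
have e3 : entry s3 14 i0 = (0, 0) by rewrite /entry /= eqxx.
have o3 z : z != i0 -> entry s3 14 z = entry s' 14 z.
  by move=> /negbTE zi; rewrite /entry /= zi.
have h3 q z : q \notin [:: 14; 15]%N -> arr s3 q z = arr s' q z.
  by rewrite !inE negb_or => /andP[/negbTE q1 /negbTE q2]; rewrite /= q1 q2.
have V3 a' j : cell n s3 7 a' j = V a' j.
  by rewrite -hV /cell /entry !h3 // !(ag.2 7) // !(ag.2 8).
suff [s4' [-> ag4 PA PB]] : exists s4', [/\ run (PIf (And (Le (Read 4 (Var 4)) (Read 0 (Var 8)))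
                      (Le (Add (Var 10) (Var 1)) (Read 1 (Var 8))))
               (PSeq (PIf (Le (Read 0 (Var 8)) (Var 10))
                       (relax 14 next_cell
                         (Add (Read 2 (Var 8)) (table_at 7 4 (Var 7)))
                         (Add (Read 13 (Var 8)) (table_at 8 4 (Var 7))))
                       PSkip)
                 (PFor 5 0 insert_relax))
               PSkip) s3 = s4', 
     agree [:: 5; 11; 12; 13]%N [:: 14; 15]%N s3 s4',
     (forall z, z != i0 -> entry s4' 14 z = entry s3 14 z) &
     insert_cell a s4' i].
  rewrite run_set.
  have e4 : var s4' 10 = R a + p * i%:Z by rewrite ag4.1.
  have p4 : var s4' 1 = p by rewrite ag4.1 // (base_p Bs3).
  split.
  - by rewrite /= e4 p4 lenS addrA.
  - move=> j; rewrite ltnS leq_eqVlt => /orP[/eqP -> //|ji].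
    have := PI j ji; rewrite /insert_cell.
    suff -> : cell n s' 14 a j.+1 = cell n s4' 14 a j.+1 by [].
    have jz : (a * n.+1 + j.+1)%N%:Z != i0.
      by apply: ne; [apply: leq_trans il; apply: leqW|rewrite eqxx /= eqSS neq_ltn ji].
    by rewrite /cell PA // o3.
  move=> a' j a'a jn; rewrite -PO // -[LHS]/(cell n s4' 14 a' j) /cell.
  by rewrite PA ?o3 //; apply: ne; rewrite ?a'a.
have v3 x : var s3 x = var s' x by [].
clearbody s3.
have s3_4 : var s3 4 = a%:Z by rewrite v3.
have s3_7 : var s3 7 = i%:Z by rewrite v3.
have s3_7e : eval s3 (Var 7) = i%:Z := s3_7.
have s3_8 : var s3 8 = k%:Z by rewrite v3.
have s3_10 : var s3 10 = R a + p * i%:Z by rewrite v3.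
rewrite run_if; case: ifP => tst; last first.
  exists s3; rewrite run_skip; split=> //; split.
    by rewrite /cell e3; apply/represents_empty/block_set0.
  move=> ak dk; move: tst.
  by rewrite /= s3_4 s3_8 s3_10 (base_R Bs3 an') (base_r Bs3) (base_d Bs3) (base_p Bs3) ak dk.
have [ak dk] : R a <= r k /\ R a + p * i%:Z + p <= d k.
  apply/andP; move: tst.
  by rewrite /= s3_4 s3_8 s3_10 (base_R Bs3 an') (base_r Bs3) (base_d Bs3) (base_p Bs3).
rewrite run_seq; set first := PIf _ _ _.
have ag5 := run_agree first s3; set s5 := run first s3 in ag5 *.
have [q1 q2 q3] : [/\ forall z, z != i0 -> entry s5 14 z = entry s3 14 z,
    represents (block_set (k |: K) a i.+1) (entry s5 14 i0) &
    r k <= R a + p * i%:Z -> weight I k + v a i <= (entry s5 14 i0).1].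
  rewrite /s5 /first run_if run_skip.
  rewrite (_ : eval_test s3 _ = (r k <= R a + p * i%:Z)); last first.
    by rewrite /= s3_8 s3_10 (base_r Bs3).
  case: (boolP (r k <= R a + p * i%:Z)) => rk; last first.
    by split=> //; rewrite e3; apply/represents_empty/block_set0.
  have [|||||r1 r2 r3 r4] := @relaxP 14 next_cell
    (Add (Read 2 (Var 8)) (table_at 7 4 (Var 7)))
    (Add (Read 13 (Var 8)) (table_at 8 4 (Var 7)))
    s3 i0 (weight I k + (V a i).1) (2 ^+ k + (V a i).2) => //.
  - exact: idxE.
  - rewrite evalD (table_at_eval _ Bs3 an' s3_4 s3_7e) -V3.
    by rewrite [eval _ (Read 2 _)]/= s3_8 (base_w Bs3).
  - rewrite evalD (table_at_eval _ Bs3 an' s3_4 s3_7e) -V3.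
    by rewrite [eval _ (Read 13 _)]/= s3_8 (base_pow Bs3) // ltnW.
  split=> //; apply: r4; first by rewrite e3; apply/represents_empty/block_set0.
  apply: (representsU1 (P1 := block_set K a i)); last exact: V_sound (ltnW il).
  by move=> J; apply: insert_set_base.
have Bs5 : base s5 by apply: base_agree ag5 _ _ Bs3.
have ag6 := run_agree (PFor 5 0 insert_relax) s5.
exists (run (PFor 5 0 insert_relax) s5).
pose Q (b : nat) s6 := [/\ forall z, z != i0 -> entry s6 14 z = entry s5 14 z,
  represents (block_set (k |: K) a i.+1) (entry s6 14 i0),
  (entry s5 14 i0).1 <= (entry s6 14 i0).1 &
  forall b' m, (b' < b)%N -> (m <= i)%N -> tick k a b' m ->
    weight I k + ((entry s 9 b'%:Z).1 + v b' (i - m)%N) <= (entry s6 14 i0).1].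
have : Q n (run (PFor 5 0 insert_relax) s5); last first.
  set s6 := run _ _ in ag6 *; case=> h1 h2 h4 h5; split=> //.
  - apply: (agree_trans (s2 := s5)).
      split=> [z|z u zn]; last exact: ag5.2.
      rewrite !inE !negb_or => /and4P[? ? ? ?].
      by rewrite ag5.1 // !inE !negb_or; apply/and3P.
    by split=> [z zn|z u zn]; [exact: ag6.1|exact: ag6.2].
  - by move=> z zi; rewrite h1 ?q1.
  split=> // _ _; split; first by move=> rk; apply: le_trans h4; apply: q3.
  by exists (fun b => (entry s 9 b%:Z).1).
apply: run_for => //; first exact: base_n Bs5.
move=> b s6 bn s65 ag7 [h1 h2 h4 h5].
have Bs6 : base s6 by apply: base_agree ag7 _ _ Bs5.
have h6 q z : q \in [:: 7; 8; 9; 10; 11]%N -> arr s6 q z = arr s q z.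
  by rewrite !inE => /or4P[/eqP->|/eqP->|/eqP->|/orP[]/eqP->];
    rewrite ag7.2 // ag5.2 // h3 // ag.2.
have V6 a' j : cell n s6 7 a' j = V a' j by rewrite -hV /cell /entry !h6.
have s64 : var s6 4 = a%:Z by rewrite ag7.1 // ag5.1.
have s67 : var s6 7 = i%:Z by rewrite ag7.1 // ag5.1.
have s68 : var s6 8 = k%:Z by rewrite ag7.1 // ag5.1.
have skip : (forall m, (m <= i)%N -> tick k a b m -> False) ->
    Q b.+1 (set_var s6 5 b.+1%:Z).
  move=> sk; split=> // b2 m; rewrite ltnS leq_eqVlt => /orP[/eqP ->|b2b].
    by move=> mi /(sk m mi).
  exact: h5.
rewrite /insert_relax run_if run_skip.
have [[c6 nt]|[m [mn tk c6 f6 [T1 T2 T3]]]] := cc b bn.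
  rewrite (_ : eval_test s6 _ = false); last first.
    by rewrite /= s65 s67 h6 // c6 lez_nat ltnNge ltnW.
  apply: skip => m mi tk; have mn : (m <= n)%N by apply: leq_trans mi (ltnW il).
  by have := nt m mn; rewrite tk.
rewrite (_ : eval_test s6 _ = (m <= i)%N); last first.
  by rewrite /= s65 s67 h6 // c6 lez_nat.
case: (boolP (m <= i)%N) => mi; last first.
  by apply: skip => m' m'i /(tick_uniq tk) mm'; rewrite mm' m'i in mi.
have cE : eval s6 (Defs.Sub (Var 7) (Read 11 (Var 5))) = (i - m)%N%:Z.
  by rewrite /= s67 s65 h6 // c6 subzn.
have [|||||r1 r2 r3 r4] := @relaxP 14 next_cell
    (Add (Read 2 (Var 8))
         (Add (Read 9 (Var 5)) (table_at 7 5 (Defs.Sub (Var 7) (Read 11 (Var 5))))))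
    (Add (Read 13 (Var 8))
         (Add (Read 10 (Var 5)) (table_at 8 5 (Defs.Sub (Var 7) (Read 11 (Var 5))))))
    s6 i0 (weight I k + ((entry s 9 b%:Z).1 + (V b (i - m)%N).1))
    (2 ^+ k + ((entry s 9 b%:Z).2 + (V b (i - m)%N).2)) => //.
- exact: idxE.
- rewrite !evalD (table_at_eval _ Bs6 (ltnW bn) s65 cE) -V6.
  by rewrite [eval _ (Read 2 _)]/= [eval _ (Read 9 _)]/= s68 s65 (base_w Bs6) h6.
- rewrite !evalD (table_at_eval _ Bs6 (ltnW bn) s65 cE) -V6.
  rewrite [eval _ (Read 13 _)]/= [eval _ (Read 10 _)]/= s68 s65.
  by rewrite (base_pow Bs6 (ltnW (ltn_ord k))) (h6 10).
set s7 := run _ s6 in r1 r2 r3 r4.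
split.
- by move=> z zi; rewrite -h1 //; apply: r1.
- apply: r4 => //.
  (* The set without [k] is remembered as a chain plus a last block, the form in which [k] can be
     added to it. *)
  apply: (representsU1 (e := (_, _)) (P1 := fun J => exists J1 J2,
      [/\ J = J1 :|: J2, [disjoint J1 & J2], chain_set K k a b m J1 & block_set K b (i - m) J2])).
    move=> J [J1 [J2 [-> _ cJ1 bJ2]]].
    by have [] := @insert_set_chain n I len_gt0 R K k a b i m J1 J2.
  have im : (i - m <= n)%N by apply: leq_trans (leq_subr _ _) (ltnW il).
  apply: representsU T1 (V_sound bn im) => J1 J2 cJ1 bJ2.
  have [dis _ _] := @insert_set_chain n I len_gt0 R K k a b i m J1 J2 k_new k_last ak dk mi tk cJ1 bJ2.
  by split=> //; exists J1, J2.
- exact: le_trans r2.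
move=> b2 m2; rewrite ltnS leq_eqVlt => /orP[/eqP ->|b2b].
  by move=> _ tk2; rewrite -(tick_uniq tk tk2).
by move=> m2i tk2; apply: le_trans r2; apply: h5.
Qed.

Lemma phase1P s : base s -> (forall a i, cell n s 7 a i = V a i) ->
  var s 8 = k%:Z ->
  forall a i, (a < n)%N -> (i < n)%N -> insert_cell a (run phase1 s) i.
Proof.
move=> Bs hV s8.
pose P (a : nat) s' := forall a' i, (a' < a)%N -> (i < n)%N -> insert_cell a' s' i.
suff : P n (run phase1 s) by [].
apply: run_for => //; first exact: base_n Bs.
move=> a s' an sa ag Ps'; rewrite run_seq.
have Bs' : base s' by apply: base_agree ag _ _ Bs.
have ag1 := run_agree chain_row s'.
have cc : forall b, (b < n)%N -> chain_cell a (run chain_row s') b.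
  apply: chain_rowP => //; last by rewrite ag.1.
  by move=> a' i; rewrite -hV; apply: entry_agree ag _ _.
set s1 := run chain_row s' in ag1 cc *.
have Bs1 : base s1 by apply: base_agree ag1 _ _ Bs'.
have [|||h1 h2] := @insert_rowP s1 a Bs1 _ an _ _ cc.
- move=> a' i; rewrite -hV; apply: eq_trans (entry_agree _ ag _ _) => //.
  exact: entry_agree ag1 _ _.
- by rewrite ag1.1.
- by rewrite ag1.1 // ag.1.
move=> a' i; rewrite ltnS leq_eqVlt => /orP[/eqP ->|a'a il]; first exact: h1.
suff : insert_cell a' (run insert_row s1) i by [].
have := Ps' a' i a'a il; rewrite /insert_cell h2 ?ltn_eqF //.
by rewrite /cell (entry_agree _ ag1).
Qed.

End Phases.

(** * Concatenation of blocks *)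

Section Joining.

Variables (K : {set 'I_n}) (a : nat).
Hypothesis an : (a < n)%N.

Notation V s := (cell n s 7).

(** Monotonicity permits updates in place: whatever is read from the row later is at least its
    initial value. *)
Definition row_step s s' : Prop :=
  [/\ sound K (V s'),
      forall a' i, a' != a -> (i <= n)%N -> V s' a' i = V s a' i
    & forall i, (i <= n)%N -> (V s a i).1 <= (V s' a i).1].

Lemma row_step_refl s : sound K (V s) -> row_step s s.
Proof. by []. Qed.

Lemma row_step_trans s1 s2 s3 : row_step s1 s2 -> row_step s2 s3 -> row_step s1 s3.
Proof.
move=> [h1 h2 h3] [g1 g2 g3]; split=> // [a' i a'a il|i il]; first by rewrite g2 ?h2.
exact: le_trans (h3 i il) (g3 i il).
Qed.

Lemma relax_row s i x y (j : nat) x0 y0 : sound K (V s) -> (j <= n)%N ->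
  (forall u, eval (set_var s 11 u) y = eval s y) ->
  (forall u u', eval (set_var (set_var s 11 u) 12 u') i = eval s i) ->
  eval s i = (a * n.+1 + j)%N%:Z -> eval s x = x0 -> eval s y = y0 ->
  represents (block_set K a j) (x0, y0) ->
  row_step s (run (relax 7 i x y) s) /\ x0 <= (V (run (relax 7 i x y) s) a j).1.
Proof.
move=> Ss jn hy hi ei ex ey rep.
have [r1 r2 r3 r4] := relaxP 7 hy hi ei ex ey.
have other a' i' : (i' <= n)%N -> (a' != a) || (i' != j) ->
    V (run (relax 7 i x y) s) a' i' = V s a' i'.
  move=> i'n ne; apply: r1; apply: contraL ne => /eqP.
  by move=> /(cell_index_inj i'n jn) [-> ->]; rewrite !eqxx.
split=> //; split=> [a' i' a'n i'n|a' i' a'a i'n|i' i'n].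
- have [/andP[/eqP -> /eqP ->]|] := boolP ((a' == a) && (i' == j)).
    by apply: r4 => //; apply: Ss.
  by rewrite negb_and => ne; rewrite other //; apply: Ss.
- by rewrite other ?a'a.
have [->|ij] := eqVneq i' j; first exact: r2.
by rewrite other ?ij ?orbT.
Qed.

Lemma copy_rowP s : base s -> var s 4 = a%:Z -> sound K (V s) ->
  (forall i, (i < n)%N -> represents (block_set K a i.+1) (cell n s 14 a i.+1)) ->
  row_step s (run copy_row s) /\
  forall i, (0 < i)%N -> (i <= n)%N ->
    (cell n s 14 a i).1 <= (V (run copy_row s) a i).1.
Proof.
move=> Bs s4 Ss hA; have an' := ltnW an.
pose P (i : nat) s' := row_step s s' /\ forall j, (j < i)%N ->
  (cell n s 14 a j.+1).1 <= (V s' a j.+1).1.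
have : P n (run copy_row s); last by case=> h1 h2; split=> // -[//|i] _ il; exact: h2.
apply: run_for => //; first exact: base_n Bs.
move=> i s' il si ag [h1 h2].
have Bs' : base s' by apply: base_agree ag _ _ Bs.
have s'4 : var s' 4 = a%:Z by rewrite ag.1.
have eA q : q \in [:: 14; 15]%N ->
    eval s' (Read q next_cell) = arr s q (a * n.+1 + i.+1)%N%:Z.
  rewrite !inE => /orP[]/eqP->; rewrite [LHS]/= s'4 (base_row Bs' an') si ag.2 //;
    by congr (arr s _ _); lia.
have [||||||||h3 h4] := @relax_row s' next_cell (Read 14 next_cell) (Read 15 next_cell)
  i.+1 (cell n s 14 a i.+1).1 (cell n s 14 a i.+1).2 => //.
- by case: h1.
- by rewrite /= s'4 (base_row Bs' an') si -addn1; lia.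
- exact: eA.
- exact: eA.
- by rewrite -surjective_pairing; apply: hA.
split; first exact: row_step_trans h3.
move=> j; rewrite ltnS leq_eqVlt => /orP[/eqP -> //|ji].
by apply: le_trans (h2 j ji) _; case: h3 => _ _; apply; apply: leq_trans il; apply: leqW.
Qed.

Lemma join_rowP s : base s -> var s 4 = a%:Z -> sound K (V s) ->
  row_step s (run join_row s) /\
  forall b m i, (b < n)%N -> R a + p * m%:Z = R b -> (m + i <= n)%N ->
    (V s a m).1 + (V s b i).1 <= (V (run join_row s) a (m + i)%N).1.
Proof.
move=> Bs s4 Ss; have an' := ltnW an.
pose P (b : nat) s' := row_step s s' /\ forall b' m i, (b' < b)%N ->
  R a + p * m%:Z = R b' -> (m + i <= n)%N ->
    (V s a m).1 + (V s b' i).1 <= (V s' a (m + i)%N).1.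
suff : P n (run join_row s) by [].
apply: run_for => //; first exact: base_n Bs.
move=> b s' bn sb ag [h1 h2]; have bn' := ltnW bn.
have Bs' : base s' by apply: base_agree ag _ _ Bs.
have s'4 : var s' 4 = a%:Z by rewrite ag.1.
have [m [mn e9 e10 c1 c2]] := count_stepsP Bs' an' bn' s'4 sb.
have ag1 := run_agree count_steps s'.
rewrite run_seq; set s1 := run count_steps s' in e9 e10 ag1 *.
have Bs1 : base s1 by apply: base_agree ag1 _ _ Bs'.
have s14 : var s1 4 = a%:Z by rewrite ag1.1.
have s15 : var s1 5 = b%:Z by rewrite ag1.1.
have V1 a' i : V s1 a' i = V s' a' i by apply: entry_agree ag1 _ _.
have h11 : row_step s s1.
  by case: h1 => g1 g2 g3; split=> [a' i *|a' i *|i *]; rewrite V1; auto.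
have h12 b' m' i : (b' < b)%N -> R a + p * m'%:Z = R b' -> (m' + i <= n)%N ->
    (V s a m').1 + (V s b' i).1 <= (V s1 a (m' + i)%N).1.
  by rewrite V1; apply: h2.
rewrite run_if run_skip (_ : eval_test s1 _ = (R a + p * m%:Z == R b)); last first.
  by rewrite /= e10 s15 (base_R Bs1 bn').
case: (boolP (R a + p * m%:Z == R b)) => [/eqP|/eqP] tm; last first.
  split=> // b' m' i; rewrite ltnS leq_eqVlt => /orP[/eqP ->|]; last exact: h12.
  move=> tm' m'n; case: tm; rewrite -tm'; congr (_ + p * _%:Z).
  apply/eqP; rewrite eqn_leq; apply/andP; split; rewrite leqNgt; apply/negP => lt.
    case: c1 => [m0|c1]; first by rewrite m0 in lt.
    by have := len_leM len_gt0 lt; rewrite lenS; lia.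
  case: c2 => [mE|c2]; first by rewrite mE in lt; lia.
  by have := len_leM len_gt0 lt; rewrite lenS; lia.
pose Q (i : nat) s6 := row_step s1 s6 /\ forall i', (i' < i)%N -> (m + i' <= n)%N ->
  (V s1 a m).1 + (V s1 b i').1 <= (V s6 a (m + i')%N).1.
have : Q n.+1 (run (PFor 7 2 join_relax) s1).
  apply: run_for => //; first exact: base_n1 Bs1.
    by split=> //; apply: row_step_refl; case: h11.
  move=> i s6 il si ag6 [g1 g2].
  have Bs6 : base s6 by apply: base_agree ag6 _ _ Bs1.
  have s64 : var s6 4 = a%:Z by rewrite ag6.1.
  have s65 : var s6 5 = b%:Z by rewrite ag6.1.
  have s69 : eval s6 (Var 9) = m%:Z by rewrite /= ag6.1.
  have s67 : eval s6 (Var 7) = i%:Z by [].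
  have s60 : eval s6 (Var 0) = n%:Z := base_n Bs6.
  have s6a : eval s6 (Add (Var 9) (Var 7)) = (m + i)%N%:Z by rewrite evalD s69 s67.
  rewrite /join_relax run_if run_skip.
  rewrite (_ : eval_test s6 _ = (m + i <= n)%N); last by rewrite -lez_nat -s60 -s6a.
  case: (boolP (m + i <= n)%N) => min; last first.
    split=> // i'; rewrite ltnS leq_eqVlt => /orP[/eqP ->|]; last exact: g2.
    by rewrite (negbTE min).
  have [Ss6 _ _] := g1.
  have [||||||g3 g4] := @relax_row s6 (cell_index 4 (Add (Var 9) (Var 7)))
     (Add (table_at 7 4 (Var 9)) (table_at 7 5 (Var 7)))
     (Add (table_at 8 4 (Var 9)) (table_at 8 5 (Var 7))) (m + i)
     ((V s6 a m).1 + (V s6 b i).1) ((V s6 a m).2 + (V s6 b i).2) Ss6 min => //.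
  - exact: cell_index_eval s6a.
  - by rewrite evalD (table_at_eval _ Bs6 an' s64 s69) (table_at_eval _ Bs6 bn' s65 s67).
  - by rewrite evalD (table_at_eval _ Bs6 an' s64 s69) (table_at_eval _ Bs6 bn' s65 s67).
  - apply: (representsU (P1 := block_set K a m) (P2 := block_set K b i)).
    + by move=> J1 J2; apply: join_set.
    + exact: Ss6.
    + by apply: Ss6 => //; lia.
  split; first exact: row_step_trans g3.
  move=> i'; rewrite ltnS leq_eqVlt => /orP[/eqP ->|i'i] min'.
    apply: le_trans g4; case: g1 => _ g12 g13; apply: lerD; first exact: g13.
    (* The row read may be row [a] itself, which has changed meanwhile, but only upwards. *)
    have [->|ba] := eqVneq b a; first by apply: g13; lia.
    by rewrite g12 //; lia.
  by apply: le_trans (g2 i' i'i min') _; case: g3 => _ _; apply.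
set s6 := run (PFor 7 2 join_relax) s1; case=> [g1 g2].
split; first exact: row_step_trans h11 g1.
move=> b' m' i; rewrite ltnS leq_eqVlt => /orP[/eqP ->|b'b] tm' m'n; last first.
  by apply: le_trans (h12 b' m' i b'b tm' m'n) _; case: g1 => _ _; apply.
have mm' : m' = m.
  have e : p * m'%:Z = p * m%:Z by lia.
  have p0 : p != 0 by have := len_gt0; lia.
  by case: (mulfI p0 e).
rewrite mm' in m'n *; apply: le_trans (g2 i _ m'n); last by lia.
case: h11 => _ g12 g13; apply: lerD; first exact: g13.
have [->|ba] := eqVneq b a; first by apply: g13; lia.
by rewrite g12 //; lia.
Qed.

End Joining.
Notation values V := (fun a i => (V a i).1).

Lemma phase2P s K (A V : nat -> nat -> int * int) : base s ->
  (forall a i, cell n s 7 a i = V a i) -> (forall a i, cell n s 14 a i = A a i) ->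
  sound K V ->
  (forall a i, (a < n)%N -> (i < n)%N -> represents (block_set K a i.+1) (A a i.+1)) ->
  sound K (cell n (run phase2 s) 7) /\
  join_table I R (values V) (values A) (values (cell n (run phase2 s) 7)).
Proof.
move=> Bs hV hA Ss SA.
pose row_done s' a := (forall i, (i <= n)%N -> (V a i).1 <= (cell n s' 7 a i).1 /\
    ((0 < i)%N -> (A a i).1 <= (cell n s' 7 a i).1)) /\
  forall b m i, (b < n)%N -> R a < R b -> R a + p * m%:Z = R b -> (m + i <= n)%N ->
    (V a m).1 + (cell n s' 7 b i).1 <= (cell n s' 7 a (m + i)%N).1 /\
    (A a m).1 + (cell n s' 7 b i).1 <= (cell n s' 7 a (m + i)%N).1.
(* After [x] rounds the last [x] rows are finished and the others are still those of [V]. *)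
pose P (x : nat) s' := [/\ sound K (cell n s' 7),
  forall a, (a < n)%N -> (n <= x + a)%N -> row_done s' a &
  forall a i, (x + a < n)%N -> (i <= n)%N -> cell n s' 7 a i = V a i].
have : P n (run phase2 s).
  apply: run_for => //; first exact: base_n Bs.
    split=> // [a i an il|a an|]; first by rewrite -[represents _ _]/(represents _ (cell n s 7 a i)) hV; apply: Ss.
      by rewrite add0n leqNgt an.
    by move=> a i _ _; apply: hV.
  move=> x s' xn sx ag [PS PD PO].
  have Bs' : base s' by apply: base_agree ag _ _ Bs.
  pose a := (n - x.+1)%N; have an : (a < n)%N by rewrite /a; lia.
  rewrite !run_seq run_set (_ : eval s' _ = a%:Z); last first.
    by rewrite /= (base_n Bs') sx /a; lia.
  set s1 := set_var s' 4 a%:Z.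
  have Bs1 : base s1 by apply: base_set_var.
  have C1 q b i : cell n s1 q b i = cell n s' q b i by [].
  have A1 b i : cell n s1 14 b i = A b i.
    by rewrite C1 -hA; apply: entry_agree ag _ _.
  have V1 i : (i <= n)%N -> cell n s1 7 a i = V a i.
    by move=> il; rewrite C1 PO //; rewrite /a; lia.
  have e4 : var s1 4 = a%:Z by [].
  have [|h1 h2] := copy_rowP an Bs1 e4 PS.
    by move=> i il; rewrite A1; apply: SA.
  have ag2 := run_agree copy_row s1; set s2 := run copy_row s1 in h1 h2 ag2 *.
  have Bs2 : base s2 by apply: base_agree ag2 _ _ Bs1.
  have [||h3 h4] := @join_rowP K a an s2 Bs2; [by rewrite ag2.1|by case: h1|].
  set s3 := run join_row s2 in h3 h4 *.
  have [S3 O13 M13] := row_step_trans h1 h3.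
  have [S2 O12 M12] := h1; have [_ O23 M23] := h3.
  suff : P x.+1 s3 by [].
  have rowa : row_done s3 a.
    split=> [i il|b m i bn ab tm mi].
      split; first by rewrite -V1 //; apply: M13.
      by move=> i0; rewrite -A1; apply: le_trans (h2 i i0 il) (M23 i il).
    have ba : b != a by apply/eqP => ba; move: ab; rewrite ba ltxx.
    have [mn il] : (m <= n)%N /\ (i <= n)%N by lia.
    have m0 : (0 < m)%N.
      by rewrite lt0n; apply/eqP => m0; move: tm ab; rewrite m0 mulr0 addr0 => ->; rewrite ltxx.
    have h := h4 b m i bn tm mi; rewrite O23 //; split; apply: le_trans h; apply: lerD => //.
      by rewrite -V1 //; apply: M12.
    by rewrite -A1; apply: h2.
  split=> // [a' a'n xa'|a' i xa' il]; last first.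
    by rewrite O13 //; [apply: PO; lia|rewrite /a; lia].
  have [->//|a'a] := eqVneq a' a.
  have [g1 g2] : row_done s' a' by apply: PD => //; move: a'a; rewrite /a; lia.
  split=> [i il|b m i bn ab tm mi]; first by rewrite O13 // C1; apply: g1.
  (* A finished row refers only to rows of later starts, so the change of row [a] does not affect
     it. *)
  have ba : b != a.
    have := R_lt R_mono a'n ab; move: xa' a'a; rewrite /a; lia.
  have il : (i <= n)%N by lia.
  by rewrite !O13 // !C1; apply: g2.
set s' := run phase2 s; case=> [h1 h2 _]; split=> // a an.
by have [g1 g2] := h2 a an (leq_addr _ _).
Qed.

(** * The loop over the jobs and the final chain *)

Lemma process_jobsP s : base s -> (forall j : 'I_n, arr s 6 j%:Z = 0) ->
  (forall a i, cell n s 7 a i = (0, 0)) ->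
  sound setT (cell n (run process_jobs s) 7) /\
  block_complete I R setT (values (cell n (run process_jobs s) 7)).
Proof.
move=> Bs h6 h7.
(* The third clause makes the processed jobs an initial segment in the order of deadlines, so the
   next one has the largest deadline so far. *)
pose P (m : nat) s' := exists K, [/\ #|K| = m,
  forall j : 'I_n, (arr s' 6 j%:Z == 0) = (j \notin K),
  forall i j, i \in K -> j \notin K -> d i <= d j,
  sound K (cell n s' 7) & block_complete I R K (values (cell n s' 7))].
have : P n (run process_jobs s); last first.
  case=> K [cK _ _ sK bK]; suff <- : K = setT by [].
  by apply/eqP; rewrite eqEcard subsetT cardsT card_ord cK leqnn.
apply: run_for => //; first exact: base_n Bs.
  exists set0; split=> //.
  - by rewrite cards0.
  - by move=> j; rewrite /= h6 inE.
  - by move=> i j; rewrite inE.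
  - move=> a i an il; rewrite -[cell _ _ _ _ _]/(cell n s 7 a i) h7.
    by apply/represents_empty/block_set0.
  move=> J a an; rewrite subset0 => /eqP -> _ _.
  by rewrite total0 -[cell _ _ _ _ _]/(cell n s 7 _ _) h7.
move=> m s' mn sm ag [K [cK mK dK sK bK]].
have Bs' : base s' by apply: base_agree ag _ _ Bs.
have KT : K != setT.
  by apply: contraTneq mn => KT; rewrite -leqNgt -cK KT cardsT card_ord.
have [k [ek kK kmin]] := selectP (base_n Bs') (base_d Bs') mK KT.
have ag1 := run_agree (select_min 1 6) s'.
rewrite !run_seq run_store; set s1 := run (select_min 1 6) s' in ek ag1 *.
have Bs1 : base s1 by apply: base_agree ag1 _ _ Bs'.
set s2 := set_arr s1 6 _ _.
have Bs2 : base s2 by apply: base_set_arr.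
have V2 a i : cell n s2 7 a i = cell n s' 7 a i by exact: (entry_agree _ ag1 _ _).
have Kk j : j \in K -> d j <= d k by move=> jK; apply: dK.
have e28 : var s2 8 = k%:Z by [].
have p1 := phase1P kK Kk sK Bs2 V2 e28.
have ag3 := run_agree phase1 s2; set s3 := run phase1 s2 in p1 ag3 *.
have Bs3 : base s3 by apply: base_agree ag3 _ _ Bs2.
have V3 a i : cell n s3 7 a i = cell n s' 7 a i.
  by rewrite -V2; apply: (entry_agree _ ag3 _ _).
have sK' : sound (k |: K) (cell n s' 7).
  move=> a i an il; apply: represents_sub (sK a i an il) => J.
  by apply: block_setS; apply: subsetU1.
have [||S4 J4] := @phase2P s3 (k |: K) (cell n s3 14) (cell n s' 7) Bs3 V3 _ sK' => //.
  by move=> a i an il; have [] := p1 a i an il.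
have ag4 := run_agree phase2 s3; set s4 := run phase2 s3 in S4 J4 ag4 *.
suff : P m.+1 s4 by [].
exists (k |: K); split=> //.
- by rewrite cardsU1 kK cK.
- move=> j; rewrite ag4.2 // ag3.2 //= ek !inE negb_or eqz_nat.
  rewrite (_ : (nat_of_ord j == k) = (j == k)) //; case: (j == k) => //=.
  by rewrite ag1.2.
- move=> i j; rewrite !inE negb_or => /predU1P[->|iK] /andP[jk jK]; first exact: kmin.
  exact: dK.
apply: (@block_complete_step n I len_gt0 R R_mono R_release K k (values (cell n s' 7))
  (values (cell n s3 14))) => //.
move=> a i an il ak dk; have [_ h] := p1 a i an il; exact: h.
Qed.

Lemma final_chainP s : base s -> sound setT (cell n s 7) ->
  (forall b, (b <= n)%N -> represents (final_set I R b) (entry (run final_chain s) 16 b%:Z)) /\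
  final_table I R (values (cell n s 7)) (fun b => (entry (run final_chain s) 16 b%:Z).1).
Proof.
move=> Bs sV.
pose V := cell n s 7.
pose good_at s' b := represents (final_set I R b) (entry s' 16 b%:Z) /\
  (0 <= (entry s' 16 b%:Z).1 /\ forall b' i, (b' < b)%N -> (b' < n)%N -> (i <= n)%N ->
   R b' + p * i%:Z <= R b -> (entry s' 16 b'%:Z).1 + (V b' i).1 <= (entry s' 16 b%:Z).1).
pose P (b : nat) s' := forall b', (b' < b)%N -> good_at s' b'.
have : P n.+1 (run final_chain s); last first.
  move=> h; split=> [b bn|b bn]; first by have [] := h b bn.
  have [_ [h1 h2]] := h b bn; split=> // b' i b'b; apply: h2 => //.
  exact: leq_trans b'b bn.
apply: run_for => //; first exact: base_n1 Bs.
move=> b s' bn sb ag Ps'; rewrite ltnS in bn.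
have Bs' : base s' by apply: base_agree ag _ _ Bs.
have V' a i : cell n s' 7 a i = V a i by apply: entry_agree ag _ _.
rewrite !run_seq !run_store; set s1 := set_arr (set_arr s' _ _ _) _ _ _.
have e1 : entry s1 16 b%:Z = (0, 0) by rewrite /entry /= sb eqxx.
have o1 b' : (b' < b)%N -> entry s1 16 b'%:Z = entry s' 16 b'%:Z.
  by move=> b'b; rewrite /entry /= sb eqz_nat ltn_eqF.
have Bs1 : base s1 by do 2!apply: base_set_arr => //.
have V1 a i : cell n s1 7 a i = V a i by rewrite -V'.
have sb1 : var s1 5 = b%:Z by [].
clearbody s1.
(* The predicate [ok] records which pairs [(b', i)] have been treated, so that both nested loops
   share one invariant. *)
pose inv (ok : nat -> nat -> Prop) s6 := [/\
  forall b', (b' < b)%N -> entry s6 16 b'%:Z = entry s1 16 b'%:Z,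
  represents (final_set I R b) (entry s6 16 b%:Z), 0 <= (entry s6 16 b%:Z).1 &
  forall b' i, ok b' i -> (b' < b)%N -> (i <= n)%N -> R b' + p * i%:Z <= R b ->
   (entry s1 16 b'%:Z).1 + (V b' i).1 <= (entry s6 16 b%:Z).1].
pose loop := PFor 6 0 (PSeq (PSet 10 (Read 4 (Var 6)))
      (PFor 7 2 (PSeq final_relax (PSet 10 (Add (Var 10) (Var 1)))))).
have : inv (fun b' _ => b' < n)%N (run loop s1).
  apply: (@run_for _ _ _ s1 n (fun m s6 => inv (fun b' _ => b' < m)%N s6)) => //.
  - exact: base_n Bs1.
  - have e10 : entry (set_var s1 6 0) 16 b%:Z = (0, 0) := e1.
    by split=> //; rewrite e10 //; apply/represents_empty/final_set0.
  move=> b' s2 b'n sb' ag2 [g1 g2 g3 g4].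
  have Bs2 : base s2 by apply: base_agree ag2 _ _ Bs1.
  rewrite run_seq run_set (_ : eval s2 _ = R b'); last first.
    by rewrite /= sb' (base_R Bs2) // ltnW.
  set s3 := set_var s2 10 (R b'); have Bs3 : base s3 by apply: base_set_var.
  pose Q (i : nat) s6 := var s6 10 = R b' + p * i%:Z /\
    inv (fun b2 j => (b2 < b') || ((b2 == b') && (j < i)))%N s6.
  set inner := PFor 7 2 _.
  have : Q n.+1 (run inner s3); last first.
    case=> _ [k1 k2 k3 k4]; split=> // b2 i; rewrite ltnS leq_eqVlt => b2b' lt il.
    by apply: k4 => //; rewrite ltnS il andbT orbC.
  apply: run_for => //; first exact: base_n1 Bs3.
    split; first by rewrite /= mulr0 addr0.
    split=> // b2 i; rewrite ltn0 andbF orbF; exact: g4.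
  move=> i s6 il si ag6 [e10 [k1 k2 k3 k4]].
  have Bs6 : base s6 by apply: base_agree ag6 _ _ Bs3.
  have s65 : var s6 5 = b%:Z by rewrite ag6.1 // [LHS]/= ag2.1.
  have s66 : var s6 6 = b'%:Z by rewrite ag6.1.
  have s67 : eval s6 (Var 7) = i%:Z by [].
  have V6 a j : cell n s6 7 a j = V a j.
    rewrite -V1; apply: eq_trans (entry_agree _ ag6 _ _) _ => //.
    by rewrite -[entry s3 _ _]/(entry s2 7 _); apply: entry_agree ag2 _ _.
  rewrite run_seq run_set; set s7 := run final_relax s6.
  have ag7 := run_agree final_relax s6; rewrite -/s7 in ag7.
  have Bs7 : base s7 by apply: base_agree ag7 _ _ Bs6.
  have e7 : eval s7 (Add (Var 10) (Var 1)) = R b' + p * i.+1%:Z.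
    by rewrite /= ag7.1 // e10 (base_p Bs7) lenS addrA.
  split; first by rewrite e7.
  suff : inv (fun b2 j => (b2 < b') || ((b2 == b') && (j < i.+1)))%N s7 by [].
  rewrite /s7 /final_relax run_if run_skip.
  rewrite (_ : eval_test s6 _ = (b' < b)%N && (R b' + p * i%:Z <= R b)); last first.
    by rewrite /= s65 s66 e10 (base_R Bs6 bn) lez_nat -ltnNge.
  have skip s8 : inv (fun b2 j => (b2 < b') || ((b2 == b') && (j < i)))%N s8 ->
     ((b' < b)%N -> R b' + p * i%:Z <= R b ->
       (entry s1 16 b'%:Z).1 + (V b' i).1 <= (entry s8 16 b%:Z).1) ->
     inv (fun b2 j => (b2 < b') || ((b2 == b') && (j < i.+1)))%N s8.
    move=> [l1 l2 l3 l4] l5; split=> // b2 j /orP[lt|/andP[/eqP ->]].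
      by apply: l4; rewrite lt.
    rewrite ltnS leq_eqVlt => /orP[/eqP -> b'b _|ji]; first exact: l5.
    by apply: l4; rewrite eqxx ji orbT.
  case: (boolP ((b' < b)%N && (R b' + p * i%:Z <= R b))) => [/andP[b'b tm]|nt]; last first.
    by apply: skip => // b'b tm; rewrite b'b tm in nt.
  have b'n' := ltnW b'n.
  have [|||||r1 r2 r3 r4] := @relaxP 16 (Var 5)
     (Add (Read 16 (Var 6)) (table_at 7 6 (Var 7)))
     (Add (Read 17 (Var 6)) (table_at 8 6 (Var 7))) s6 b%:Z
     ((entry s1 16 b'%:Z).1 + (V b' i).1) ((entry s1 16 b'%:Z).2 + (V b' i).2) => //.
  - by rewrite evalD (table_at_eval _ Bs6 b'n' s66 s67) -V6 -k1 //= s66.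
  - by rewrite evalD (table_at_eval _ Bs6 b'n' s66 s67) -V6 -k1 //= s66.
  apply: skip => [|_ _]; last exact: r3.
  split.
  - by move=> b2 b2b; rewrite -k1 //; apply: r1; rewrite eqz_nat ltn_eqF.
  - apply: r4 => //.
    apply: (representsU (P1 := final_set I R b') (P2 := block_set setT b' i)).
    + by move=> J1 J2; apply: final_set_step.
    + by rewrite o1 //; have [] := Ps' b' b'b.
    + exact: sV.
  - exact: le_trans r2.
  by move=> b2 j hj b2b jn tm2; apply: le_trans r2; apply: k4.
rewrite -/loop; set s6 := run loop s1; case=> [h1 h2 h3 h4].
suff : forall b', (b' < b.+1)%N -> good_at s6 b' by [].
move=> b'; rewrite ltnS leq_eqVlt => /orP[/eqP ->|b'b].
  split=> //; split=> // b2 i b2b b2n il tm; rewrite h1 //; exact: h4.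
have [l1 [l2 l3]] := Ps' b' b'b; rewrite /good_at h1 // o1 //; split=> //; split=> //.
move=> b2 i b2b'; have b2b := ltn_trans b2b' b'b.
by rewrite h1 // o1 //; apply: l3.
Qed.

(** * Decoding the set *)

Definition low_codes J (m : nat) : int := \sum_(j in J | (j < m)%N) 2 ^+ j.

Lemma low_codesS J (m : nat) (mn : (m < n)%N) :
  low_codes J m.+1 = (if Ordinal mn \in J then 2 ^+ m else 0) + low_codes J m.
Proof.
have ltS (j : 'I_n) : (j < m.+1)%N = (j == Ordinal mn) || (j < m)%N.
  by rewrite ltnS leq_eqVlt.
case: ifP => mJ.
  rewrite /low_codes (bigD1 (Ordinal mn)) /=; last by rewrite mJ ltnSn.
  congr (_ + _); apply: eq_bigl => j; rewrite ltS -val_eqE /= -andbA; congr (_ && _).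
  by case: ltngtP.
rewrite add0r; apply: eq_bigl => j; rewrite ltS; case: eqP => [->|//].
by rewrite mJ.
Qed.

(** Distinct powers below [2 ^ m] sum to less than [2 ^ m], so comparing with [2 ^ m] decides
    membership of [m]. *)
Lemma low_codes_bounds J (m : nat) : (m <= n)%N -> 0 <= low_codes J m < 2 ^+ m.
Proof.
elim: m => [|m IH] mn; first by rewrite /low_codes big_pred0 // => j; rewrite andbF.
rewrite (low_codesS J mn) exprS; have := IH (ltnW mn).
by case: ifP => _; lia.
Qed.

Lemma decodeP s J : base s -> (entry s 16 n%:Z).2 = codes J ->
  (forall j : 'I_n, arr s 3 j%:Z = 0) ->
  output_set n (run decode s) = J.
Proof.
move=> Bs cJ h3; rewrite /decode run_seq run_set.
set s1 := set_var s 15 _; have Bs1 : base s1 by apply: base_set_var.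
(* Variable 15 keeps the code of the members below [n - x], those not decoded yet. *)
pose P (x : nat) s' := var s' 15 = low_codes J (n - x) /\
  forall j : 'I_n, (arr s' 3 j%:Z != 0) = (j \in J) && (n - x <= j)%N.
set body := PFor 5 0 _.
have : P n (run body s1); last first.
  by case=> _ h; apply/setP => j; rewrite inE h subnn andbT.
apply: run_for => //; first exact: base_n Bs1.
  split=> [|j]; last by rewrite subn0 leqNgt ltn_ord andbF /= h3.
  rewrite /= (base_n Bs) -[LHS]/(entry s 16 n%:Z).2 cJ subn0.
  by apply: eq_bigl => j; rewrite ltn_ord andbT.
move=> x s' xn sx ag [h1 h2].
have Bs' : base s' by apply: base_agree ag _ _ Bs1.
pose m := (n - x.+1)%N; have mn : (m < n)%N by rewrite /m; lia.
have mE : (n - x = m.+1)%N by rewrite /m; lia.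
rewrite run_seq run_set (_ : eval s' _ = m%:Z); last first.
  by rewrite /= (base_n Bs') sx /m; lia.
set s2 := set_var s' 4 m%:Z.
have bm := low_codes_bounds J (ltnW mn).
rewrite mE (low_codesS J mn) in h1; rewrite mE in h2.
have jm (j : 'I_n) : (j%:Z == m%:Z) = (j == Ordinal mn) by [].
rewrite run_if run_skip (_ : eval_test s2 _ = (Ordinal mn \in J)); last first.
  by rewrite /= (base_pow Bs' (ltnW mn)) h1; case: (_ \in J); lia.
case: ifP h1 => mJ h1; rewrite /P -/m; last first.
  split=> [|j]; first by rewrite /= h1 add0r.
  rewrite [arr _ _ _]/(arr s' 3 j%:Z) h2 [in RHS]leq_eqVlt.
  case: (eqVneq (m : nat) j) => //= mj.
  by rewrite (_ : j = Ordinal mn) ?mJ //; apply: val_inj.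
rewrite run_seq run_set run_store; split=> [|j].
  by rewrite /= (base_pow Bs' (ltnW mn)) h1; lia.
rewrite /= jm leq_eqVlt; case: (eqVneq j (Ordinal mn)) => [->|jne] /=.
  by rewrite mJ eqxx.
rewrite h2; congr (_ && _); move: jne; rewrite -val_eqE /=.
by rewrite eq_sym => /negbTE ->.
Qed.

End Correctness.

(** * Set-up and the whole program *)

Section Main.

Variables (n : nat) (I : jobs n).
Hypothesis len_gt0 : 1 <= len I.

Implicit Types (J K : {set 'I_n}) (s : store).

Notation r := (release I).
Notation d := (deadline I).

Lemma make_tablesP s : var s 0 = n%:Z -> var s 2 = n.+1%:Z -> arr s 12 0 = 0 ->
  forall j, (j <= n)%N -> arr (run make_tables s) 13 j%:Z = 2 ^+ j /\
    arr (run make_tables s) 12 j%:Z = (j * n.+1)%N%:Z.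
Proof.
move=> s0 s2 a0.
pose P (i : nat) s' := forall j, (j <= i)%N ->
  arr s' 13 j%:Z = 2 ^+ j /\ arr s' 12 j%:Z = (j * n.+1)%N%:Z.
suff : P n (run make_tables s) by [].
rewrite /make_tables run_seq run_store; apply: run_for => //.
  by move=> j; rewrite leqn0 => /eqP ->; rewrite /= a0.
move=> i s' il si ag h j; rewrite !run_seq !run_store leq_eqVlt => /orP[/eqP ->|ji].
  have s'2 : var s' 2 = n.+1%:Z by rewrite ag.1.
  have [h1 h2] := h i (leqnn i).
  have iE : (i.+1%:Z == i%:Z + 1) by rewrite -addn1.
  rewrite /= si iE h1 h2 s'2 exprS; split; first by lia.
  by rewrite mulSn; lia.
have jE : (j%:Z == i%:Z + 1) = false by apply/eqP; lia.
by rewrite /= si jE; apply: h.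
Qed.

Lemma sort_releasesP s : var s 0 = n%:Z ->
  (forall j : 'I_n, arr s 0 j%:Z = r j) -> (forall j : 'I_n, arr s 5 j%:Z = 0) ->
  let s' := run sort_releases s in
  (forall a b, (a <= b < n)%N -> arr s' 4 a%:Z <= arr s' 4 b%:Z) /\
  (forall j, exists2 b, (b < n)%N & arr s' 4 b%:Z = r j).
Proof.
move=> s0 hr h5 /=.
(* Selection sort: by the last clause, placed values are at most all remaining ones, so the next
   minimum extends the sorted prefix. *)
pose P (m : nat) s' := exists K, [/\ #|K| = m,
  forall j : 'I_n, (arr s' 5 j%:Z == 0) = (j \notin K),
  forall j, j \in K -> exists2 b, (b < m)%N & arr s' 4 b%:Z = r j,
  forall a b, (a <= b < m)%N -> arr s' 4 a%:Z <= arr s' 4 b%:Z &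
  forall b j, (b < m)%N -> j \notin K -> arr s' 4 b%:Z <= r j].
have : P n (run sort_releases s); last first.
  case=> K [cK _ hK mK _]; split=> // j; apply: hK.
  suff -> : K = setT by rewrite inE.
  by apply/eqP; rewrite eqEcard subsetT cardsT card_ord cK leqnn.
apply: run_for => //.
  exists set0; split=> //.
  - by rewrite cards0.
  - by move=> j; rewrite /= h5 inE.
  - by move=> j; rewrite inE.
  - by move=> a b; rewrite ltn0 andbF.
move=> m s' mn sm ag [K [cK mK hK moK leK]].
have s'0 : var s' 0 = n%:Z by rewrite ag.1.
have hr' (j : 'I_n) : arr s' 0 j%:Z = r j by rewrite ag.2.
have KT : K != setT.
  by apply: contraTneq mn => KT; rewrite -leqNgt -cK KT cardsT card_ord.
have [k [ek kK kmin]] := selectP s'0 hr' mK KT.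
have ag1 := run_agree (select_min 0 5) s'.
rewrite !run_seq !run_store; set s1 := run (select_min 0 5) s' in ek ag1 *.
have e3 : var s1 3 = m%:Z by rewrite ag1.1.
set s2 := set_arr _ 5 _ _.
have h4 (b : nat) : arr s2 4 b%:Z = if b == m then r k else arr s' 4 b%:Z.
  by rewrite /s2 /= ek e3 eqz_nat; case: eqP => // _; rewrite ag1.2 ?hr'.
have h5' (j : 'I_n) : (arr s2 5 j%:Z == 0) = (j \notin k |: K).
  rewrite /s2 /= ek !inE negb_or eqz_nat (_ : (nat_of_ord j == k) = (j == k)) //.
  by case: (j == k) => //=; rewrite ag1.2 ?mK.
clearbody s2; have h4' u b : arr (set_var s2 3 u) 4 b%:Z = _ := h4 b.
exists (k |: K); split=> //.
- by rewrite cardsU1 kK cK.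
- move=> j; rewrite !inE => /predU1P[->|/hK[b bm rb]].
    by exists m => //; rewrite h4' eqxx.
  by exists b; [exact: leqW|rewrite h4' ltn_eqF].
- move=> a b /andP[ab]; rewrite ltnS leq_eqVlt; rewrite !h4' => /orP[/eqP bm|bm].
    rewrite bm eqxx; case: eqP => // am; apply: leK kK; lia.
  by rewrite !ltn_eqF ?(leq_ltn_trans ab) //; apply: moK; rewrite ab.
move=> b j; rewrite ltnS leq_eqVlt h4' !inE negb_or => /orP[/eqP ->|bm] /andP[_ jK].
  by rewrite eqxx; apply: kmin.
by rewrite ltn_eqF //; apply: leK.
Qed.

Lemma set_sentinelP s : var s 0 = n%:Z -> (forall j : 'I_n, arr s 1 j%:Z = d j) ->
  let s' := run set_sentinel s in
  [/\ forall b, (b < n)%N -> arr s' 4 b%:Z = arr s 4 b%:Z,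
      (0 < n)%N -> arr s 4 n.-1%:Z <= arr s' 4 n%:Z &
      forall j, d j <= arr s' 4 n%:Z].
Proof.
move=> s0 hd s'; rewrite {}/s' /set_sentinel !run_seq run_set run_store.
set s1 := set_var s 10 _; set body := PFor 3 0 _.
have ag1 := run_agree body s1.
pose P (m : nat) s' := ((0 < n)%N -> arr s 4 n.-1%:Z <= var s' 10) /\
  forall j : 'I_n, (j < m)%N -> d j <= var s' 10.
have : P n (run body s1).
  apply: run_for => //.
    by split=> //= n0; rewrite s0 (_ : n%:Z - 1 = n.-1%:Z) //; lia.
  move=> i s' il si ag [h1 h2]; pose ji := Ordinal il.
  have e1 : arr s' 1 i%:Z = d ji by rewrite ag.2 // -hd.
  rewrite run_if run_skip run_set /= si e1 -ltNge.
  have hS (u : int) : (forall j : 'I_n, (j < i)%N -> d j <= u) -> d ji <= u ->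
      forall j : 'I_n, (j < i.+1)%N -> d j <= u.
    move=> g1 g2 j; rewrite ltnS leq_eqVlt => /orP[/eqP jE|/g1//].
    by rewrite (_ : j = ji) //; apply: val_inj.
  case: ltrP => lt; split=> //=.
  - by move=> /h1 h; apply: le_trans h (ltW lt).
  - by apply: hS => // j /h2 h; apply: le_trans h (ltW lt).
  exact: hS.
set s2 := run body s1 in ag1 *; case=> [h1 h2].
have e0 : var s2 0 = n%:Z by rewrite ag1.1.
split=> [b bn|n0|j] /=; rewrite e0 eqz_nat ?eqxx.
- by rewrite ltn_eqF // ag1.2.
- exact: h1.
exact: h2.
Qed.

(** The value [n + 1] is supplied from outside because a well-formed [prg] cannot assign its own
    loop bounds. *)
Lemma main_prgP s : s = set_var (input_store I) 2 n.+1%:Z ->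
  good I (output_set n (run main_prg s)) /\
  forall J, good I J -> set_weight I J <= set_weight I (output_set n (run main_prg s)).
Proof.
move=> sE; rewrite /main_prg !run_seq.
have sr (j : 'I_n) : arr s 0 j%:Z = r j by rewrite sE /= /input_array valK.
have sd (j : 'I_n) : arr s 1 j%:Z = d j by rewrite sE /= /input_array valK.
have sw (j : 'I_n) : arr s 2 j%:Z = weight I j by rewrite sE /= /input_array valK.
have sz a z : (2 < a)%N -> arr s a z = 0 by rewrite sE; case: a => [|[|[|]]].
have s0 : var s 0 = n%:Z by rewrite sE.
have s1 : var s 1 = len I by rewrite sE.
have s2 : var s 2 = n.+1%:Z by rewrite sE.
clear sE.
have tabs := make_tablesP s0 s2 (sz 12 0 isT).
have ag1 := run_agree make_tables s; set t1 := run make_tables s in tabs ag1 *.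
have [|||mono rels] := @sort_releasesP t1.
- by rewrite ag1.1.
- by move=> j; rewrite ag1.2.
- by move=> j; rewrite ag1.2 // sz.
have ag2 := run_agree sort_releases t1; set t2 := run sort_releases t1 in mono rels ag2 *.
have [||keep last all] := @set_sentinelP t2.
- by rewrite ag2.1 // ag1.1.
- by move=> j; rewrite ag2.2 // ag1.2.
have ag3 := run_agree set_sentinel t2.
set t3 := run set_sentinel t2 in keep last all ag3 *.
pose R b := arr t3 4 b%:Z.
have R_mono a b : (a <= b <= n)%N -> R a <= R b.
  case/andP => ab; rewrite leq_eqVlt => /orP[/eqP bn|bn]; last first.
    by rewrite /R !keep ?(leq_ltn_trans ab) //; apply: mono; rewrite ab.
  move: ab; rewrite bn leq_eqVlt => /orP[/eqP -> //|an].
  rewrite /R keep //; apply: le_trans (last _); last by lia.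
  by apply: mono; lia.
have R_release j : exists2 b, (b < n)%N & R b = r j.
  by have [b bn rb] := rels j; exists b => //; rewrite /R keep.
have zero a z : a \notin [:: 0; 1; 2; 4; 5; 12; 13]%N -> arr t3 a z = 0.
  rewrite !inE !negb_or => /and5P[a0 a1 a2 a4 /and3P[a5 a12 a13]].
  rewrite ag3.2 ?ag2.2 ?ag1.2 ?sz //=;
    by rewrite ?inE ?negb_or ?a4 ?a5 ?a12 ?a13 //; move: a a0 a1 a2 {a4 a5 a12 a13} => [|[|[|]]].
have Bs3 : base I R t3.
  split=> //.
  - by rewrite ag3.1 // ag2.1 // ag1.1.
  - by rewrite ag3.1 // ag2.1 // ag1.1.
  - by rewrite ag3.1 // ag2.1 // ag1.1.
  - by move=> j; rewrite ag3.2 // ag2.2 // ag1.2.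
  - by move=> j; rewrite ag3.2 // ag2.2 // ag1.2.
  - by move=> j; rewrite ag3.2 // ag2.2 // ag1.2.
  - by move=> a an; rewrite ag3.2 // ag2.2 //; apply: (tabs a an).2.
  - by move=> a an; rewrite ag3.2 // ag2.2 //; apply: (tabs a an).1.
have [||S4 C4] := process_jobsP len_gt0 R_mono R_release Bs3.
- by move=> j; apply: zero.
- by move=> a i; rewrite /cell /entry !zero.
have ag4 := run_agree process_jobs t3; set t4 := run process_jobs t3 in S4 C4 ag4 *.
have Bs4 := base_agree ag4 isT isT Bs3.
have [S5 C5] := final_chainP len_gt0 Bs4 S4.
have ag5 := run_agree final_chain t4; set t5 := run final_chain t4 in S5 C5 ag5 *.
have Bs5 := base_agree ag5 isT isT Bs4.
have [J [gJ dJ] eJ] := S5 n (leqnn n).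
rewrite (decodeP len_gt0 Bs5 (J := J)); last first.
- by move=> j; rewrite ag5.2 // ag4.2 // zero.
- by rewrite eJ.
split=> // J' gJ'.
have := final_complete len_gt0 R_mono R_release all C4 C5 gJ'.
by rewrite eJ.
Qed.

End Main.

Theorem theorem1 :
  exists (prog : cmd) (C : nat),
  forall (n : nat) (I : jobs n), valid_jobs I ->
  exists (s : store) (k : nat),
    [/\ exec prog (input_store I) s k,
        (0 < n)%N -> (k <= C * n ^ 4)%N,
        max_weight_feasible I (output_set n s),
        exists S : assignment n, edf_schedule I (output_set n s) S
      & forall S : assignment n,
          edf_schedule I (output_set n s) S -> optimal_schedule I S].
Proof.
exists (Seq (Assign 2 (Add (Var 0) (Const 1))) (compile main_prg)).
(* Computing [n + 1] costs 4 steps, and [n + 1 <= 2 n] turns the fourth power of [n + 1] into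
   [2 ^ 4 * n ^ 4]. *)
exists (4 + coef main_prg * 2 ^ 4)%N => n I [len_gt0 _].
have [gJ best] := main_prgP len_gt0 (erefl _).
pose s0 := set_var (input_store I) 2 n.+1%:Z.
have bounded y : y \in bounds -> 0 <= var s0 y <= n.+1%:Z.
  by rewrite !inE => /orP[]/eqP-> /=; lia.
have [k ex kle] := exec_run main_prg_wf (ltn0Sn n) bounded.
exists (run main_prg s0), (4 + k)%N.
have [h1 h2 h3] := best_good_optimal len_gt0 gJ best.
split=> //.
  apply: ExecSeq ex; rewrite /s0 (_ : n.+1%:Z = eval (input_store I) (Add (Var 0) (Const 1))).
    exact: ExecAssign.
  by rewrite /= -addn1.
move=> n0; rewrite main_prg_depth in kle.
have le4 : (n.+1 ^ 4 <= 2 ^ 4 * n ^ 4)%N.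
  by rewrite -expnMn leq_exp2r //; lia.
have : (coef main_prg * n.+1 ^ 4 <= coef main_prg * (2 ^ 4 * n ^ 4))%N.
  by rewrite leq_mul2l le4 orbT.
have : (0 < n ^ 4)%N by rewrite expn_gt0 n0.
move: kle; set c := coef main_prg; set u := (n ^ 4)%N; set v := (n.+1 ^ 4)%N.
rewrite mulnDl mulnA; lia.
Qed.
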